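(* Let $K$ be a field, let $R_1,\dots,R_m$ be a friendly family of standard graded $K$-algebras, and let $T=R_1\sharp\cdots\sharp R_m$. If $M_i$ is a finitely generated graded $R_i$-module for $i=1,\dots,m$, then the natural map $$\alpha: M_1^\ast\sharp\cdots\sharp M_m^\ast\to (M_1\sharp\cdots\sharp M_m)^\ast$$ is an isomorphism of graded $T$-modules.
   Context: A standard graded $K$-algebra is a commutative $\mathbb{N}$-graded $K$-algebra $R=\bigoplus_{i\ge 0}R_i$ with $R_0=K$, generated over $K$ by finitely many elements of degree $1$. For a graded module $M$ and $a\in\mathbb{Z}$, $M(a)$ is the shifted module with $M(a)_k=M_{a+k}$. Dual: for a finitely generated graded $R$-module $M$, $M^\ast=\operatorname{Hom}_R(M,R)$ is graded by $M^\ast=\bigoplus_{i\in\mathbb{Z}}M^\ast_i$ with $M^\ast_i=\{\varphi\in\operatorname{Hom}_R(M,R):\varphi(M_k)\subseteq R_{k+i}\text{ for all }k\}$. Segre product: for standard graded $K$-algebras $R_1,\dots,R_m$, $R_1\sharp\cdots\sharp R_m=\bigoplus_{j\ge 0}(R_1)_j\otimes_K\cdots\otimes_K(R_m)_j$, which is a standard graded $K$-algebra $T$; for graded $R_i$-modules $M_i$, $M_1\sharp\cdots\sharp M_m=\bigoplus_{j\in\mathbb{Z}}(M_1)_j\otimes_K\cdots\otimes_K(M_m)_j$, a graded $T$-module. The dual $(M_1\sharp\cdots\sharp M_m)^\ast$ is taken over $T$, and each $M_i^\ast$ over $R_i$. Natural map: $\alpha: M_1^\ast\sharp\cdots\sharp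 M_m^\ast\to (M_1\sharp\cdots\sharp M_m)^\ast$ is the homogeneous $T$-linear map determined by $\alpha(\varphi_1\otimes\cdots\otimes\varphi_m)(x_1\otimes\cdots\otimes x_m)=\varphi_1(x_1)\otimes\cdots\otimes\varphi_m(x_m)$, for $\varphi_i\in (M_i^\ast)_j$ ($j$ common to all $i$) and $x_i\in (M_i)_k$ ($k$ common to all $i$). Friendly family: $R_1,\dots,R_m$ is called friendly if the natural map $\alpha:R_1(a_1)^\ast\sharp\cdots\sharp R_m(a_m)^\ast\to (R_1(a_1)\sharp\cdots\sharp R_m(a_m))^\ast$ is an isomorphism for all integers $a_1,\dots,a_m$. *)

(* Defs.v *)
From HB Require Import structures.
From mathcomp Require Import all_boot all_order all_algebra.
From mathcomp Require Import ring_quotient.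
From mathcomp Require Import boolp classical_sets functions cardinality fsbigop.
From mathcomp Require Import freeg.

Set Implicit Arguments.
Unset Strict Implicit.
Unset Printing Implicit Defensive.

Import GRing.Theory.
Local Open Scope classical_set_scope.
Local Open Scope ring_scope.

Section Span.
Variables (A : pzRingType) (V : lmodType A).

Inductive lspan (S : set V) : V -> Prop :=
| lspan0 : lspan S 0
| lspanZD a x y : S x -> lspan S y -> lspan S (a *: x + y).

Definition finitely_generated : Prop :=
  exists s : seq V, forall x, lspan [set` s] x.

Lemma lspan_mem (S : set V) x : S x -> lspan S x.
Proof. by move=> Sx; rewrite -[x]scale1r -[_ *: _]addr0; apply: lspanZD (lspan0 _). Qed.

Lemma lspanP (S : set V) a x y :
  lspan S x -> lspan S y -> lspan S (a *: x + y).
Proof.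
move=> Sx Sy; elim: Sx => [|b u v Su _ IH]; first by rewrite scaler0 add0r.
by rewrite scalerDr scalerA -addrA; apply: lspanZD.
Qed.

Lemma lspan_submod_closed (S : set V) : submod_closed [pred x | `[< lspan S x >]].
Proof.
split=> [|a x y]; rewrite !inE; [exact: lspan0 | exact: lspanP].
Qed.

Lemma lspan_ind_linear (S : set V) (P : V -> Prop) :
    P 0 -> (forall a x y, P x -> P y -> P (a *: x + y)) ->
    (forall x, S x -> P x) -> forall x, lspan S x -> P x.
Proof. by move=> P0 PD PS x; elim=> // a u v /PS Pu _; apply: PD. Qed.

Lemma lspan_sub (S S' : set V) : S `<=` S' -> forall x, lspan S x -> lspan S' x.
Proof.
move=> SS x; elim=> [|a u v /SS Su _ IH]; first exact: lspan0.
exact: lspanZD.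
Qed.
End Span.

Section Grading.
Variables (J : choiceType) (V : zmodType) (D : J -> set V).

Definition homogeneous_decomposition (x : V) (c : J -> V) : Prop :=
  [/\ forall j, D j (c j), finite_set [set j | c j != 0]
    & x = \sum_(j \in [set: J]) c j].

(* V is the internal direct sum of the subgroups D j. *)
Definition is_grading : Prop :=
  (forall j, D j 0 /\ forall x y, D j x -> D j y -> D j (x - y)) /\
  (forall x, exists! c, homogeneous_decomposition x c).

Definition hcomp (x : V) : J -> V :=
  xget (fun=> 0) [set c | homogeneous_decomposition x c].

Lemma fsum_seq (c : J -> V) (s : seq J) : uniq s ->
  (forall j, j \notin s -> c j = 0) ->
  \sum_(j \in [set: J]) c j = \sum_(j <- s) c j.
Proof.
move=> us cs; rewrite (fsbigE s) //; last by move=> i _; apply: cs.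
by apply: congr_big => // i; rewrite in_setT.
Qed.

Lemma homogeneous_decomposition_seq x c (s : seq J) : uniq s ->
  (forall j, D j (c j)) -> (forall j, j \notin s -> c j = 0) ->
  x = \sum_(j <- s) c j -> homogeneous_decomposition x c.
Proof.
move=> us Dc cs ->; split; rewrite ?(fsum_seq us) //.
apply: (@sub_finite_set _ _ [set` s]); last by apply/finite_seqP; exists s.
by move=> j /= cj; apply: contra_neqT cj; apply: cs.
Qed.

Hypothesis gD : is_grading.

Lemma grading0 j : D j 0. Proof. by case: (gD.1 j). Qed.
Lemma gradingB j x y : D j x -> D j y -> D j (x - y).
Proof. by case: (gD.1 j) => _; apply. Qed.
Lemma gradingN j x : D j x -> D j (- x).
Proof. by move=> Dx; rewrite -[- x]add0r; apply/gradingB/Dx/grading0. Qed.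
Lemma gradingD j x y : D j x -> D j y -> D j (x + y).
Proof. by move=> Dx /gradingN Dy; rewrite -[y]opprK; apply: gradingB. Qed.
Lemma grading_sum j I (s : seq I) (P : pred I) (f : I -> V) :
  (forall i, P i -> D j (f i)) -> D j (\sum_(i <- s | P i) f i).
Proof. by move=> Df; apply: big_ind => //; [exact: grading0 | exact: gradingD]. Qed.

Lemma hcompP x : homogeneous_decomposition x (hcomp x).
Proof. by have [c [dc _]] := gD.2 x; apply: (xgetI _ dc). Qed.

Lemma hcomp_unique x c : homogeneous_decomposition x c -> c = hcomp x.
Proof.
by have [c' [_ uc]] := gD.2 x => dc; rewrite -(uc _ dc) (uc _ (hcompP x)).
Qed.

Lemma hcomp_deg x j : D j (hcomp x j). Proof. by case: (hcompP x). Qed.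

Lemma hcomp_finite x : exists2 s : seq J, uniq s &
  forall j, j \notin s -> hcomp x j = 0.
Proof.
have [_ /finite_seqP[s sE] _] := hcompP x.
exists (undup s); first exact: undup_uniq.
move=> j; rewrite mem_undup => js; apply: contraNeq js => cj.
by have : [set` s] j by rewrite -sE.
Qed.

Lemma hcomp_sum x (s : seq J) : uniq s -> (forall j, j \notin s -> hcomp x j = 0) ->
  x = \sum_(j <- s) hcomp x j.
Proof. by move=> us xs; case: (hcompP x) => _ _; rewrite (fsum_seq us). Qed.

Lemma hcomp_eq x c (s : seq J) : uniq s ->
  (forall j, D j (c j)) -> (forall j, j \notin s -> c j = 0) ->
  x = \sum_(j <- s) c j -> forall j, hcomp x j = c j.
Proof.
move=> us Dc cs xE j.
by rewrite (hcomp_unique (homogeneous_decomposition_seq us Dc cs xE)).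
Qed.

Lemma hcompB x y j : hcomp (x - y) j = hcomp x j - hcomp y j.
Proof.
have [s us xs] := hcomp_finite x; have [t ut yt] := hcomp_finite y.
have ust := undup_uniq (s ++ t).
have st k : k \notin undup (s ++ t) -> k \notin s /\ k \notin t.
  by rewrite mem_undup mem_cat negb_or => /andP.
apply: (@hcomp_eq _ (fun j => hcomp x j - hcomp y j) _ ust).
- by move=> k; apply: gradingB; apply: hcomp_deg.
- by move=> k /st[/xs-> /yt->]; rewrite subrr.
- rewrite sumrB -!hcomp_sum // => k /st[]; first by move=> _ /yt.
  by move=> /xs.
Qed.

Lemma hcomp0 j : hcomp 0 j = 0.
Proof. by have := hcompB 0 0 j; rewrite !subrr. Qed.

Lemma hcompD x y j : hcomp (x + y) j = hcomp x j + hcomp y j.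
Proof. by rewrite -{1}[y]opprK -[- y]sub0r 2!hcompB hcomp0 sub0r opprK. Qed.

Lemma hcomp_big I (s : seq I) (f : I -> V) j :
  hcomp (\sum_(i <- s) f i) j = \sum_(i <- s) hcomp (f i) j.
Proof.
by apply: (big_morph (hcomp^~ j)) => [x y|]; [exact: hcompD | exact: hcomp0].
Qed.

Lemma hcomp_hom j k x : D j x -> hcomp x k = if k == j then x else 0.
Proof.
move=> Dx; apply: (@hcomp_eq _ (fun k => if k == j then x else 0) [:: j]) => //.
- by move=> i; case: eqP => [->//|_]; apply: grading0.
- by move=> i; rewrite inE => /negPf->.
- by rewrite big_seq1 eqxx.
Qed.

Lemma grading_ind (P : V -> Prop) :
  P 0 -> (forall x y, P x -> P y -> P (x + y)) ->
  (forall j x, D j x -> P x) -> forall x, P x.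
Proof.
move=> P0 PD Ph x; have [s us xs] := hcomp_finite x.
rewrite (hcomp_sum us xs); apply: big_ind => // j _.
exact/(Ph j)/hcomp_deg.
Qed.
End Grading.

(* An N-grading seen as a Z-grading that vanishes in negative degrees. *)
Definition int_degree (V : zmodType) (D : nat -> set V) (j : int) : set V :=
  match j with Posz n => D n | Negz _ => [set 0] end.

Lemma int_degree_grading (V : zmodType) (D : nat -> set V) :
  is_grading D -> is_grading (int_degree D).
Proof.
move=> gD; split=> [[n|n]|x]; first exact: gD.1.
  by split=> //= x y -> ->; rewrite subrr.
have [s us xs] := hcomp_finite gD x.
exists (fun j => if j is Posz n then hcomp D x n else 0); split.
  apply: (@homogeneous_decomposition_seq _ _ _ _ _ [seq Posz n | n <- s]).
  - by rewrite map_inj_uniq // => ? ? [].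
  - by case=> [n|n] //=; apply: hcomp_deg.
  - by case=> [n|n] //=; rewrite mem_map => [/xs//|? ? []].
  - by rewrite big_map; apply: hcomp_sum.
move=> c [Dc fc xE]; apply/funext; case=> [n|n]; last by have := Dc (Negz n).
move: fc => /finite_seqP[t tE].
pose N := (\max_(j <- t) absz j).+1.
have cN n' : (N <= n')%N -> c (Posz n') = 0.
  move=> Nn; apply/eqP/negP => /negP cn.
  have : [set` t] (Posz n') by rewrite -tE.
  rewrite /= => nt; have := @leq_bigmax_seq _ t xpredT absz (Posz n') nt isT.
  by rewrite /= leqNgt Nn.
have : x = \sum_(k <- iota 0 N) c (Posz k).
  rewrite xE (@fsum_seq _ _ _ [seq Posz n | n <- iota 0 N]) ?big_map //.
    by rewrite map_inj_uniq ?iota_uniq // => ? ? [].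
  case=> [k|k]; last by have := Dc (Negz k).
  rewrite mem_map; last by move=> ? ? [].
  by rewrite mem_iota /= add0n -leqNgt; apply: cN.
move/(hcomp_eq gD (c := fun k => c (Posz k)) (iota_uniq 0 N)); apply=> k.
  by have := Dc (Posz k).
by rewrite mem_iota /= add0n -leqNgt; apply: cN.
Qed.

Section GradedStructures.
Variable K : fieldType.

(* A [comAlgType] is nontrivial, so k |-> k%:A is injective and [adeg0P]
   identifies the component of degree 0 with K. *)
Record stdGradedAlg := StdGradedAlg {
  galg :> comAlgType K;
  adeg : nat -> set galg;
  adeg_grading : is_grading adeg;
  adegM : forall i j x y, adeg i x -> adeg j y -> adeg (i + j)%N (x * y);
  adeg0P : forall x, adeg 0%N x <-> exists k : K, x = k%:A;
  adeg1_gen : exists2 s : seq galg, (forall x, x \in s -> adeg 1%N x) &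
    forall S : {pred galg}, subalg_closed S -> {subset s <= S} ->
    forall x, x \in S
}.

Record gradedMod (R : stdGradedAlg) := GradedMod {
  gmod :> lmodType R;
  mdeg : int -> set gmod;
  mdeg_grading : is_grading mdeg;
  mdegZ : forall i j a x, adeg i a -> mdeg j x -> mdeg (Posz i + j) (a *: x)
}.

Record fgGradedMod (R : stdGradedAlg) := FgGradedMod {
  fgmod :> gradedMod R;
  fgmod_fg : finitely_generated fgmod
}.
End GradedStructures.

Section Regular.
Variables (K : fieldType) (R : stdGradedAlg K).

Lemma int_adeg_grading : is_grading (int_degree (@adeg K R)).
Proof. exact/int_degree_grading/adeg_grading. Qed.

Lemma int_adegM i (j : int) (a x : R) :
  adeg i a -> int_degree (@adeg K R) j x ->
  int_degree (@adeg K R) (Posz i + j) (a * x).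
Proof.
case: j => [j|j] Da; first exact: adegM.
move=> ->; rewrite mulr0; exact: (grading0 int_adeg_grading).
Qed.

(* R as a graded module over itself. *)
Definition regular_gmod : gradedMod R :=
  @GradedMod K R R^o (int_degree (@adeg K R)) int_adeg_grading int_adegM.

Lemma regular_fg : finitely_generated regular_gmod.
Proof.
exists [:: 1] => x; rewrite -[x]mulr1 -[x * 1]addr0.
by apply: (lspanZD x _ (lspan0 _)); rewrite /= inE.
Qed.

Definition regular_fgmod : fgGradedMod R := FgGradedMod regular_fg.
End Regular.

Section Shift.
Variables (K : fieldType) (R : stdGradedAlg K) (M : fgGradedMod R) (a : int).

Lemma shift_grading : is_grading (fun k => @mdeg K R M (a + k)).
Proof.
have gM := @mdeg_grading K R M; split=> [k|x]; first exact: gM.1.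
have [s us xs] := hcomp_finite gM x.
exists (fun k => hcomp (@mdeg K R M) x (a + k)); split.
  apply: (@homogeneous_decomposition_seq _ _ _ _ _ [seq j - a | j <- s]).
  - by rewrite map_inj_uniq // => ? ? /addIr.
  - by move=> j; apply: hcomp_deg.
  - by move=> j js; apply: xs; apply: contra js => js; apply/mapP;
      exists (a + j) => //; rewrite addrAC subrr add0r.
  - rewrite big_map {1}(hcomp_sum gM us xs); apply: eq_bigr => j _.
    by rewrite addrC subrK.
move=> c [Dc /finite_seqP[t tE] xE]; apply/funext => k.
have t0 j : j \notin t -> c j = 0.
  move=> jt; apply/eqP; apply: contraNT jt => cj.
  by have : [set` t] j by rewrite -tE.
have tu := undup_uniq t.
rewrite (@hcomp_eq _ _ _ gM x (fun j => c (j - a)) [seq a + j | j <- undup t]).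
- by rewrite addrAC subrr add0r.
- by rewrite map_inj_uniq // => ? ? /addrI.
- by move=> j; have := Dc (j - a); rewrite addrC subrK.
- move=> j jt; apply: t0; apply: contra jt => jt; apply/mapP.
  by exists (j - a); rewrite ?mem_undup // addrC subrK.
- rewrite big_map xE (@fsum_seq _ _ _ (undup t)) //; last first.
    by move=> j; rewrite mem_undup; apply: t0.
  by apply: eq_bigr => j _; rewrite addrAC subrr add0r.
Qed.

Lemma shift_degZ i j b x : @adeg K R i b -> @mdeg K R M (a + j) x ->
  @mdeg K R M (a + (Posz i + j)) (b *: x).
Proof. by move=> Db Dx; rewrite addrCA; apply: mdegZ. Qed.

(* M(a)_k = M_(a + k) *)
Definition shift : fgGradedMod R :=
  @FgGradedMod K R (GradedMod shift_grading shift_degZ) (@fgmod_fg K R M).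
End Shift.

(* M with the K-action k *: x := k%:A *: x. *)
Definition restrict_scalars (K : fieldType) (R : comAlgType K) (M : lmodType R) :
  Type := M.

Section RestrictScalars.
Variables (K : fieldType) (R : comAlgType K) (M : lmodType R).
Local Notation rM := (restrict_scalars M).

HB.instance Definition _ := GRing.Zmodule.copy rM M.

Let scaleK (k : K) (x : rM) : rM := (k%:A : R) *: (x : M).

Fact scaleKA a b x : scaleK a (scaleK b x) = scaleK (a * b) x.
Proof. by rewrite /scaleK scalerA mulr_algl scalerA. Qed.
Fact scaleK1 : left_id 1 scaleK.
Proof. by move=> x; rewrite /scaleK !scale1r. Qed.
Fact scaleKDr : right_distributive scaleK +%R.
Proof. by move=> a x y; rewrite /scaleK scalerDr. Qed.
Fact scaleKDl x : {morph scaleK^~ x : a b / a + b}.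
Proof. by move=> a b; rewrite /scaleK !scalerDl. Qed.

HB.instance Definition _ :=
  GRing.Zmodule_isLmodule.Build K rM scaleKA scaleK1 scaleKDr scaleKDl.

Lemma restrict_scalarsE (k : K) (x : rM) : k *: x = (k%:A : R) *: (x : M) :> M.
Proof. by []. Qed.
End RestrictScalars.

Definition dual (A : comPzRingType) (N : lmodType A) : Type := {linear N -> A^o}.
Identity Coercion linear_of_dual : dual >-> GRing.Linear.type.

Section Dual.
Variables (A : comPzRingType) (N : lmodType A).
Local Notation dN := (dual N).
Implicit Types f g h : dN.

Lemma dualP f g : f =1 g -> f = g.
Proof.
case: f g => f [[f1] [f2]] [g [[g1] [g2]]] /= /funext fg.
subst g; congr GRing.Linear.Pack; congr GRing.Linear.Class.
  by congr Algebra.isNmodMorphism.Axioms_; apply: Prop_irrelevance.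
by congr GRing.isScalable.Axioms_; apply: Prop_irrelevance.
Qed.

HB.instance Definition _ := gen_eqMixin dN.
HB.instance Definition _ := gen_choiceMixin dN.

Definition dual_zero : dN := \0.
Definition dual_opp f : dN := \- f.
Definition dual_add f g : dN := f \+ g.
Definition dual_scale (a : A) f : dN := a \*: f.

Fact dual_addA : associative dual_add.
Proof. by move=> f g h; apply: dualP => x; apply: addrA. Qed.
Fact dual_addC : commutative dual_add.
Proof. by move=> f g; apply: dualP => x; apply: addrC. Qed.
Fact dual_add0 : left_id dual_zero dual_add.
Proof. by move=> f; apply: dualP => x; apply: add0r. Qed.
Fact dual_addN : left_inverse dual_zero dual_opp dual_add.
Proof. by move=> f; apply: dualP => x; apply: addNr. Qed.
HB.instance Definition _ :=
  GRing.isZmodule.Build dN dual_addA dual_addC dual_add0 dual_addN.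

Fact dual_scaleA a b f : dual_scale a (dual_scale b f) = dual_scale (a * b) f.
Proof. by apply: dualP => x; apply: mulrA. Qed.
Fact dual_scale1 : left_id 1 dual_scale.
Proof. by move=> f; apply: dualP => x; apply: mul1r. Qed.
Fact dual_scaleDr : right_distributive dual_scale +%R.
Proof. by move=> a f g; apply: dualP => x; apply: mulrDr. Qed.
Fact dual_scaleDl f : {morph dual_scale^~ f : a b / a + b}.
Proof. by move=> a b; apply: dualP => x; apply: mulrDl. Qed.
HB.instance Definition _ := GRing.Zmodule_isLmodule.Build A dN
  dual_scaleA dual_scale1 dual_scaleDr dual_scaleDl.

Lemma dual0E x : (0 : dN) x = 0. Proof. by []. Qed.
Lemma dualBE f g x : (f - g : dN) x = f x - g x. Proof. by []. Qed.
Lemma dualDE f g x : (f + g : dN) x = f x + g x. Proof. by []. Qed.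
Lemma dualZE a f x : (a *: f : dN) x = a * f x. Proof. by []. Qed.
Lemma dual_sumE I (s : seq I) (f : I -> dN) x :
  (\sum_(i <- s) f i : dN) x = \sum_(i <- s) f i x.
Proof. by elim/big_rec2: _ => //= i y g _ <-. Qed.

Definition dual_deg (degA : int -> set A) (degN : int -> set N) (i : int) : set dN :=
  [set f | forall k x, degN k x -> degA (k + i) (f x)].
End Dual.

Section DualGrading.
Variables (K : fieldType) (R : stdGradedAlg K) (M : fgGradedMod R).
Local Notation degR := (int_degree (@adeg K R)).
Local Notation degM := (@mdeg K R M).
Local Notation dM := (dual M).
Local Notation pR := (hcomp degR).
Local Notation pM := (hcomp degM).
Implicit Types (f : dM) (d : int).

Let gR : is_grading degR := int_adeg_grading R.
Let gM : is_grading degM := @mdeg_grading K R M.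

Let shift_notin (k : int) (s : seq int) j :
  j \notin [seq k + d | d <- s] -> j - k \notin s.
Proof.
apply: contra => ?; apply/mapP; exists (j - k) => //.
by rewrite addrC subrK.
Qed.

Lemma hcomp_homM i (a y : R) k : adeg i a -> pR (a * y) (Posz i + k) = a * pR y k.
Proof.
move=> Da; have [s us ys] := hcomp_finite gR y.
rewrite (@hcomp_eq _ _ _ gR _ (fun j => a * pR y (j - Posz i))
  [seq Posz i + j | j <- s]).
- by rewrite addrAC subrr add0r.
- by rewrite map_inj_uniq // => ? ? /addrI.
- move=> j; have /(int_adegM Da) := hcomp_deg gR y (j - Posz i).
  by rewrite [Posz i + _]addrC subrK.
- by move=> j /shift_notin/ys->; rewrite mulr0.
- rewrite big_map {1}(hcomp_sum gR us ys) mulr_sumr; apply: eq_bigr => j _.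
  by rewrite addrAC subrr add0r.
Qed.

(* The component of degree d of f maps x to \sum_k (f x_k)_(k + d). *)
Definition dual_comp_fun f d (x : M) : R :=
  \sum_(k \in [set: int]) pR (f (pM x k)) (k + d).

Lemma dual_comp_funE f d x (s : seq int) : uniq s ->
  (forall k, k \notin s -> pM x k = 0) ->
  dual_comp_fun f d x = \sum_(k <- s) pR (f (pM x k)) (k + d).
Proof.
move=> us xs; rewrite /dual_comp_fun (fsum_seq us) // => k /xs->.
by rewrite linear0 (hcomp0 gR).
Qed.

Lemma dual_comp_fun_hom f d k x : degM k x ->
  dual_comp_fun f d x = pR (f x) (k + d).
Proof.
move=> Dx; rewrite (@dual_comp_funE _ _ _ [:: k]) //.
  by rewrite big_seq1 (hcomp_hom gM _ Dx) eqxx.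
by move=> j; rewrite inE (hcomp_hom gM _ Dx) => /negPf->.
Qed.

Lemma dual_comp_funD f d x y :
  dual_comp_fun f d (x + y) = dual_comp_fun f d x + dual_comp_fun f d y.
Proof.
have [s us xs] := hcomp_finite gM x; have [t ut yt] := hcomp_finite gM y.
have ust := undup_uniq (s ++ t).
have sP k : k \notin undup (s ++ t) -> pM x k = 0.
  by rewrite mem_undup mem_cat negb_or => /andP[/xs].
have tP k : k \notin undup (s ++ t) -> pM y k = 0.
  by rewrite mem_undup mem_cat negb_or => /andP[_ /yt].
rewrite !(dual_comp_funE f d ust) // => [|k kst]; last first.
  by rewrite (hcompD gM) sP ?tP ?addr0.
rewrite -big_split; apply: eq_bigr => k _.
by rewrite (hcompD gM) linearD (hcompD gR).
Qed.

Lemma dual_comp_fun0 f d : dual_comp_fun f d 0 = 0.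
Proof. by apply: (addrI (dual_comp_fun f d 0)); rewrite -dual_comp_funD !addr0. Qed.

Lemma dual_comp_fun_linear f d : linear (dual_comp_fun f d : M -> R^o).
Proof.
have sc a x : dual_comp_fun f d (a *: x) = a * dual_comp_fun f d x.
  elim/(grading_ind gR): a => [|a b IHa IHb|[i|i] a Da].
  - by rewrite scale0r mul0r dual_comp_fun0.
  - by rewrite scalerDl mulrDl dual_comp_funD IHa IHb.
  - elim/(grading_ind gM): x => [|x y IHx IHy|k x Dx].
    + by rewrite scaler0 dual_comp_fun0 mulr0.
    + by rewrite scalerDr !dual_comp_funD mulrDr IHx IHy.
    + rewrite (dual_comp_fun_hom _ _ Dx) -(hcomp_homM _ _ Da).
      rewrite (dual_comp_fun_hom _ _ (mdegZ Da Dx)) linearZ /=.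
      by rewrite addrA.
  - by rewrite Da scale0r mul0r dual_comp_fun0.
by move=> a x y; rewrite dual_comp_funD sc.
Qed.

Definition dual_comp f d : dM :=
  HB.pack (dual_comp_fun f d : M -> R^o)
    (GRing.isLinear.Build R M R^o *:%R (dual_comp_fun f d : M -> R^o) (dual_comp_fun_linear f d)).

Lemma dual_compE f d x : dual_comp f d x = dual_comp_fun f d x.
Proof. by []. Qed.

Let uniform_finite (T : eqType) (P : T -> int -> Prop) (s : seq T) :
  (forall k, exists t : seq int, forall d, d \notin t -> P k d) ->
  exists t : seq int, forall d, d \notin t -> forall k, k \in s -> P k d.
Proof.
move=> Pt; elim: s => [|k s [t IH]]; first by exists [::].
have [t' Pk] := Pt k; exists (t ++ t') => d.
rewrite mem_cat negb_or => /andP[/IH{}IH /Pk{}Pk] k'.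
by rewrite inE => /predU1P[->//|/IH].
Qed.

Lemma dual_comp_finite f : exists2 s : seq int, uniq s &
  forall d, d \notin s -> dual_comp f d = 0.
Proof.
have [gens gensM] := @fgmod_fg K R M.
have fin_x (x : M) : exists t : seq int, forall d, d \notin t ->
    dual_comp f d x = 0.
  have [s us xs] := hcomp_finite gM x.
  have [|t Pt] := @uniform_finite int
      (fun k d => pR (f (pM x k)) (k + d) = 0) s.
    move=> k; have [t _ yt] := hcomp_finite gR (f (pM x k)).
    exists [seq j - k | j <- t] => d dt; apply: yt.
    apply: contra dt => dt; apply/mapP; exists (k + d) => //.
    by rewrite addrAC subrr add0r.
  exists t => d /Pt{}Pt; rewrite dual_compE (dual_comp_funE f d us xs).
  by rewrite big_seq big1.
have [t Pt] := uniform_finite gens fin_x.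
exists (undup t); first exact: undup_uniq.
move=> d; rewrite mem_undup => /Pt{}Pt; apply: dualP => x.
elim: (gensM x) => [|a u v /Pt fu _ fv]; first by rewrite linear0.
by rewrite linearP fu fv scaler0 addr0.
Qed.

(* This is where finite generation of M is needed. *)
Lemma dual_grading : is_grading (dual_deg degR degM).
Proof.
split=> [i|f].
  split=> [k x _|g h Dg Dh k x Dx]; first exact: (grading0 gR).
  by rewrite dualBE; apply: (gradingB gR); [apply: Dg | apply: Dh].
have [s us fs] := dual_comp_finite f.
exists (dual_comp f); split.
  apply: (homogeneous_decomposition_seq us) => //.
    move=> d k x Dx; rewrite dual_compE (dual_comp_fun_hom _ _ Dx).
    exact: hcomp_deg.
  apply: dualP => x; rewrite dual_sumE.
  elim/(grading_ind gM): x => [|x y IHx IHy|k x Dx].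
  - by rewrite linear0 big1 // => d _; rewrite linear0.
  - rewrite linearD IHx IHy -big_split; apply: eq_bigr => d _.
    by rewrite linearD.
  - rewrite {1}(@hcomp_sum _ _ _ gR (f x) [seq k + d | d <- s]).
    + rewrite big_map; apply: eq_bigr => d _.
      by rewrite dual_compE (dual_comp_fun_hom _ _ Dx).
    + by rewrite map_inj_uniq // => ? ? /addrI.
    + move=> j /shift_notin/fs/(congr1 (fun g : dM => g x)).
      by rewrite dual_compE (dual_comp_fun_hom _ _ Dx) addrC subrK.
move=> c [Dc fc xE]; apply/funext => d; apply: dualP => x; rewrite dual_compE.
have [t ut ct] : exists2 t : seq int, uniq t & forall j, j \notin t -> c j = 0.
  move: fc => /finite_seqP[t tE]; exists (undup t); rewrite ?undup_uniq // => j.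
  rewrite mem_undup => jt; apply/eqP; apply: contraNT jt => cj.
  by have : [set` t] j by rewrite -tE.
rewrite (fsum_seq ut ct) in xE.
elim/(grading_ind gM): x => [|x y IHx IHy|k x Dx].
- by rewrite linear0 dual_comp_fun0.
- by rewrite linearD dual_comp_funD IHx IHy.
- rewrite (dual_comp_fun_hom _ _ Dx) xE dual_sumE.
  rewrite (@hcomp_eq _ _ _ gR _ (fun j => c (j - k) x) [seq k + d | d <- t]).
  + by rewrite addrAC subrr add0r.
  + by rewrite map_inj_uniq // => ? ? /addrI.
  + by move=> j; have := Dc (j - k) k x Dx; rewrite [k + _]addrC subrK.
  + by move=> j /shift_notin/ct->.
  + by rewrite big_map; apply: eq_bigr => j _; rewrite addrAC subrr add0r.
Qed.

Lemma dual_degZ i j (a : R) f : adeg i a -> dual_deg degR degM j f ->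
  dual_deg degR degM (Posz i + j) (a *: f).
Proof.
by move=> Da Df k x /Df Dfx; rewrite dualZE addrCA; apply: int_adegM.
Qed.

Definition dual_gmod : gradedMod R :=
  @GradedMod K R (dual M) (dual_deg degR degM) dual_grading dual_degZ.
End DualGrading.

(* The tensor product over K of a finite family V of K-vector spaces: the free
   K-module on the dependent functions (x_i), x_i in V i, modulo multilinearity
   in each coordinate. *)
Section Tensor.
Variables (K : fieldType) (I : finType) (V : I -> lmodType K).

Definition multilinear (W : lmodType K) (f : (forall i, V i) -> W) : Prop :=
  forall (x : forall i, V i) i a (u v : V i),
    f (dfwith x (a *: u + v)) = a *: f (dfwith x u) + f (dfwith x v).

Local Notation F := {freeg (forall i, V i) / K}.

Definition tensor_gen (x : forall i, V i) : F := << x >>.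

Definition tensor_rel : set F :=
  [set z | exists x i a (u v : V i),
    z = tensor_gen (dfwith x (a *: u + v))
        - (a *: tensor_gen (dfwith x u) + tensor_gen (dfwith x v))].

Definition tensor_null : {pred F} := [pred z | `[< lspan tensor_rel z >]].

Fact tensor_null_zmod_closed : zmod_closed tensor_null.
Proof. exact: GRing.submod_closedB (lspan_submod_closed _). Qed.
HB.instance Definition _ :=
  GRing.isZmodClosed.Build F tensor_null tensor_null_zmod_closed.

Definition tensor : Type := Quotient.quot tensor_null.

HB.instance Definition _ := GRing.Zmodule.copy tensor (Quotient.quot tensor_null).

Definition tensor_pi (z : F) : tensor := (\pi_(Quotient.quot tensor_null) z)%qT.
Definition tensor_repr (t : tensor) : F := repr (t : Quotient.quot tensor_null).

Lemma tensor_reprK t : tensor_pi (tensor_repr t) = t.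
Proof. exact: reprK. Qed.

Lemma tensor_pi_eq z1 z2 : (tensor_pi z1 = tensor_pi z2) <-> lspan tensor_rel (z1 - z2).
Proof.
split=> [/eqP|z12]; first by rewrite -Quotient.idealrBE => /asboolP.
by apply/eqP; rewrite -Quotient.idealrBE; apply/asboolP.
Qed.

Lemma tensor_piB z1 z2 : tensor_pi (z1 - z2) = tensor_pi z1 - tensor_pi z2.
Proof. exact: (raddfB (\pi_(Quotient.quot tensor_null))%qT). Qed.
Lemma tensor_piD z1 z2 : tensor_pi (z1 + z2) = tensor_pi z1 + tensor_pi z2.
Proof. exact: (raddfD (\pi_(Quotient.quot tensor_null))%qT). Qed.

Definition tensor_scale (a : K) (t : tensor) : tensor :=
  tensor_pi (a *: tensor_repr t).

Lemma tensor_piZ a z : tensor_pi (a *: z) = tensor_scale a (tensor_pi z).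
Proof.
apply/tensor_pi_eq; rewrite -scalerBr -[_ *: _]addr0.
apply: lspanP (lspan0 _); apply/tensor_pi_eq.
by rewrite tensor_reprK.
Qed.

Fact tensor_scaleA a b t : tensor_scale a (tensor_scale b t) = tensor_scale (a * b) t.
Proof. by rewrite -(tensor_reprK t) -!tensor_piZ scalerA. Qed.
Fact tensor_scale1 : left_id 1 tensor_scale.
Proof. by move=> t; rewrite -(tensor_reprK t) -!tensor_piZ scale1r. Qed.
Fact tensor_scaleDr : right_distributive tensor_scale +%R.
Proof.
move=> a t u; rewrite -(tensor_reprK t) -(tensor_reprK u).
by rewrite -tensor_piD -!tensor_piZ scalerDr tensor_piD.
Qed.
Fact tensor_scaleDl t : {morph tensor_scale^~ t : a b / a + b}.
Proof.
by move=> a b; rewrite -(tensor_reprK t) -!tensor_piZ scalerDl tensor_piD.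
Qed.
HB.instance Definition _ := GRing.Zmodule_isLmodule.Build K tensor
  tensor_scaleA tensor_scale1 tensor_scaleDr tensor_scaleDl.

Lemma tensor_pi_linear : linear tensor_pi.
Proof. by move=> a z1 z2; rewrite tensor_piD tensor_piZ. Qed.

Definition pure (x : forall i, V i) : tensor := tensor_pi (tensor_gen x).

Lemma pure_multilinear : multilinear pure.
Proof.
move=> x i a u v; rewrite /pure -tensor_pi_linear.
by apply/tensor_pi_eq; apply: lspan_mem; exists x, i, a, u, v.
Qed.

Lemma freegU_scale (a : K) (x : forall i, V i) :
  << a *g x >> = a *: tensor_gen x :> F.
Proof. by apply/eqP/freeg_eqP => y; rewrite coeffZ !coeffU mul1r. Qed.

Lemma tensor_ind (P : tensor -> Prop) :
  P 0 -> (forall a x t, P t -> P (a *: pure x + t)) -> forall t, P t.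
Proof.
move=> P0 PD t; rewrite -(tensor_reprK t).
elim/freeg_ind_dom0: (tensor_repr t) => [|a x z _ _ Pz].
  by rewrite -(subrr (0 : F)) tensor_piB subrr.
by rewrite tensor_piD freegU_scale tensor_piZ; apply: PD.
Qed.

Section Lift.
Variables (W : lmodType K) (f : (forall i, V i) -> W).

(* Meaningful only when f is multilinear, see [tensor_lift_pure]. *)
Definition tensor_lift (t : tensor) : W := fglift f (tensor_repr t).

Lemma fglift_linear : linear (fglift f : F -> W).
Proof.
have fB := @lift_is_additive K (forall i, V i) W f.
have f0 : fglift f 0 = 0 by rewrite -(subrr (0 : F)) fB subrr.
have fD z1 z2 : fglift f (z1 + z2) = fglift f z1 + fglift f z2.
  by rewrite -{1}[z2]opprK fB -[- z2]sub0r fB f0 sub0r opprK.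
move=> a z1 z2; rewrite fD; congr (_ + _).
elim/freeg_ind_dom0: z1 => [|b x z _ _ IH]; first by rewrite scaler0 f0 scaler0.
rewrite scalerDr !fD IH scalerDr; congr (_ + _).
by rewrite freegU_scale scalerA -!freegU_scale !liftU scalerA.
Qed.

Hypothesis fm : multilinear f.

Lemma tensor_lift_pi z : tensor_lift (tensor_pi z) = fglift f z.
Proof.
have /tensor_pi_eq zr := tensor_reprK (tensor_pi z).
rewrite /tensor_lift; apply/eqP; rewrite -subr_eq0; apply/eqP.
rewrite -(@lift_is_additive K (forall i, V i) W f).
elim: zr => [|a _ z' [x [i [b [u [v ->]]]]] _ IH].
  by rewrite -(subrr (0 : F)) (@lift_is_additive K (forall i, V i) W f) subrr.
rewrite fglift_linear IH addr0 (@lift_is_additive K (forall i, V i) W f).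
rewrite fglift_linear !liftU !scale1r fm subrr.
by rewrite scaler0.
Qed.

Lemma tensor_lift_pure x : tensor_lift (pure x) = f x.
Proof. by rewrite tensor_lift_pi liftU scale1r. Qed.

Lemma tensor_lift_linear : linear tensor_lift.
Proof.
move=> a t u; rewrite -(tensor_reprK t) -(tensor_reprK u).
by rewrite -tensor_pi_linear !tensor_lift_pi fglift_linear.
Qed.
End Lift.

Lemma tensor_ext (W : lmodType K) (f g : tensor -> W) :
  linear f -> linear g -> (forall x, f (pure x) = g (pure x)) -> f =1 g.
Proof.
move=> fl gl fg.
have l0 (h : tensor -> W) : linear h -> h 0 = 0.
  by move=> hl; have := hl (-1) 0 0; rewrite scaler0 addr0 scaleN1r addNr.
by elim/tensor_ind => [|a x t IH]; [rewrite !l0 | rewrite fl gl fg IH].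
Qed.
End Tensor.
Arguments pure {K I V}.

Section TensorMap.
Variables (K : fieldType) (I : finType).

Definition bilinear_family (U V W : I -> lmodType K)
    (f : forall i, U i -> V i -> W i) : Prop :=
  forall i, (forall v, linear (f i ^~ v)) /\ (forall u, linear (f i u)).

(* The map sending (x_i (x) ...) , (y_i (x) ...) to (f_i x_i y_i (x) ...), see
   [tensor_map2_pure]. *)
Definition tensor_map2 (U V W : I -> lmodType K)
    (f : forall i, U i -> V i -> W i) (t : tensor U) (u : tensor V) : tensor W :=
  tensor_lift (fun x : forall i, U i =>
    tensor_lift (fun y : forall i, V i => pure (fun i => f i (x i) (y i))) u) t.

Section Bilinear.
Variables (U V W : I -> lmodType K) (f : forall i, U i -> V i -> W i).
Hypothesis fb : bilinear_family f.

Let inner_multilinear (x : forall i, U i) :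
  multilinear (fun y : forall i, V i => pure (fun i => f (x i) (y i))).
Proof.
move=> y i a u v.
have E w : (fun j => f (x j) (dfwith y w j)) =
           dfwith (fun j => f (x j) (y j)) (f (x i) w).
  apply/functional_extensionality_dep => j.
  by case: dfwithP => [|k ik]; rewrite ?dfwith_in ?dfwith_out.
by rewrite !E (fb i).2 pure_multilinear.
Qed.

Let outer_multilinear (u : tensor V) :
  multilinear (fun x : forall i, U i =>
    tensor_lift (fun y : forall i, V i => pure (fun i => f (x i) (y i))) u).
Proof.
move=> x i a s t; move: u; apply: tensor_ext => [||y].
- exact/tensor_lift_linear/inner_multilinear.
- move=> b u v; rewrite !tensor_lift_linear; try exact: inner_multilinear.
  by rewrite scalerDr !scalerDr !scalerA [b * a]mulrC addrACA.
rewrite !tensor_lift_pure; try exact: inner_multilinear.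
have E w : (fun j => f (dfwith x w j) (y j)) =
           dfwith (fun j => f (x j) (y j)) (f w (y i)).
  apply/functional_extensionality_dep => j.
  by case: dfwithP => [|k ik]; rewrite ?dfwith_in ?dfwith_out.
by rewrite !E ((fb i).1 (y i)) pure_multilinear.
Qed.

Lemma tensor_map2_pure x y :
  tensor_map2 f (pure x) (pure y) = pure (fun i => f (x i) (y i)).
Proof.
rewrite /tensor_map2 tensor_lift_pure; last exact: outer_multilinear.
by rewrite tensor_lift_pure //; apply: inner_multilinear.
Qed.

Lemma tensor_map2_linearl u : linear (tensor_map2 f ^~ u).
Proof. exact/tensor_lift_linear/outer_multilinear. Qed.

Lemma tensor_map2_linearr t : linear (tensor_map2 f t).
Proof.
move=> a u v; move: t; apply: tensor_ext => [||x].
- exact: tensor_map2_linearl.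
- move=> b s t; rewrite !tensor_map2_linearl.
  by rewrite !scalerDr !scalerA [b * a]mulrC addrACA.
rewrite /tensor_map2 !tensor_lift_pure; try exact: outer_multilinear.
by rewrite tensor_lift_linear //; apply: inner_multilinear.
Qed.
End Bilinear.

Lemma tensor_ext2 (U V : I -> lmodType K) (Z : lmodType K)
    (F G : tensor U -> tensor V -> Z) :
  (forall u, linear (F ^~ u)) -> (forall u, linear (G ^~ u)) ->
  (forall t, linear (F t)) -> (forall t, linear (G t)) ->
  (forall x y, F (pure x) (pure y) = G (pure x) (pure y)) ->
  forall t u, F t u = G t u.
Proof.
move=> Fl Gl Fr Gr FG t u; move: t.
apply: (tensor_ext (Fl u) (Gl u)) => x; move: u.
exact: (tensor_ext (Fr _) (Gr _)).
Qed.

Lemma tensor_ext3 (U V W : I -> lmodType K) (Z : lmodType K)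
    (F G : tensor U -> tensor V -> tensor W -> Z) :
  (forall u v, linear (fun t => F t u v)) ->
  (forall u v, linear (fun t => G t u v)) ->
  (forall t v, linear (fun u => F t u v)) ->
  (forall t v, linear (fun u => G t u v)) ->
  (forall t u, linear (F t u)) -> (forall t u, linear (G t u)) ->
  (forall x y z, F (pure x) (pure y) (pure z) = G (pure x) (pure y) (pure z)) ->
  forall t u v, F t u v = G t u v.
Proof.
move=> F1 G1 F2 G2 F3 G3 FG t u v; move: t.
apply: (tensor_ext (F1 u v) (G1 u v)) => x; move: u v.
by apply: tensor_ext2 => *; rewrite ?FG.
Qed.
End TensorMap.

Section TensorAlgebra.
Variables (K : fieldType) (I : finType) (A : I -> comAlgType K).

Definition tensor_alg : Type := tensor (fun i => A i : lmodType K).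
HB.instance Definition _ := GRing.Lmodule.on tensor_alg.

Definition tensor_mul : tensor_alg -> tensor_alg -> tensor_alg :=
  tensor_map2 (fun i (x y : A i) => x * y).
Definition tensor_one : tensor_alg := pure (fun i => 1 : A i).

Lemma mul_bilinear :
  @bilinear_family K I (fun i => A i) (fun i => A i) (fun i => A i)
    (fun i (x y : A i) => x * y).
Proof.
move=> i; split=> [y|x] a u v /=; first by rewrite mulrDl scalerAl.
by rewrite mulrDr scalerAr.
Qed.
Let mull := tensor_map2_linearl mul_bilinear.
Let mulr := tensor_map2_linearr mul_bilinear.

Lemma tensor_mul_pure (x y : forall i, A i) :
  tensor_mul (pure x) (pure y) = pure (fun i => x i * y i : A i).
Proof. exact: (tensor_map2_pure mul_bilinear). Qed.

Fact tensor_mulA : associative tensor_mul.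
Proof.
apply: (@tensor_ext3 K I (fun i => A i) (fun i => A i) (fun i => A i)).
- by move=> u v a s t; apply: mull.
- by move=> u v a s t; rewrite /tensor_mul !mull.
- by move=> u v a s t; rewrite /tensor_mul mull mulr.
- by move=> u v a s t; rewrite /tensor_mul mulr mull.
- by move=> u v a s t; rewrite /tensor_mul !mulr.
- by move=> u v a s t; apply: mulr.
move=> x y z; rewrite !tensor_mul_pure; congr pure.
by apply/functional_extensionality_dep => i; apply: mulrA.
Qed.

Fact tensor_mulC : commutative tensor_mul.
Proof.
apply: (@tensor_ext2 K I (fun i => A i) (fun i => A i)).
- exact: mull.
- exact: mulr.
- exact: mulr.
- by move=> t a u v; apply: mull.
move=> x y; rewrite !tensor_mul_pure; congr pure.
by apply/functional_extensionality_dep => i; apply: mulrC.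
Qed.

Fact tensor_mul1 : left_id tensor_one tensor_mul.
Proof.
apply: (@tensor_ext K I (fun i => A i)) => [||x]; first exact: mulr.
- by move=> a u v.
rewrite tensor_mul_pure; congr pure.
by apply/functional_extensionality_dep => i; apply: mul1r.
Qed.

Fact tensor_mulDl : left_distributive tensor_mul +%R.
Proof. by move=> t u v; have := mull v 1 t u; rewrite /= !scale1r. Qed.

HB.instance Definition _ := GRing.Zmodule_isComPzRing.Build tensor_alg
  tensor_mulA tensor_mulC tensor_mul1 tensor_mulDl.
End TensorAlgebra.

(* Segre products are realised inside the full tensor product over K: the
   summand (M_1)_j (x) ... (x) (M_m)_j is [segre_piece j], the span of the pure
   tensors all of whose entries have degree j.  Over a field this is a faithful
   copy of the tensor product of the (M_i)_j, and when the family is nonempty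
   the sum over j is direct ([segre_alg_grading], [segre_mod_grading]).  For an
   empty family the pieces are not independent. *)
Section Segre.
Variables (K : fieldType) (I : finType).

Section Span.
Variables (V : I -> lmodType K) (J : Type) (D : forall i, J -> set (V i)).

Definition segre_pure (j : J) : set (tensor V) :=
  [set t | exists2 x : forall i, V i, (forall i, D j (x i)) & t = pure x].

Definition segre_piece (j : J) : set (tensor V) := lspan (segre_pure j).

Definition segre_set : set (tensor V) :=
  lspan [set t | exists j, segre_pure j t].

Definition segre_pred : {pred tensor V} := [pred t | `[< segre_set t >]].

Lemma segre_submod_closed : submod_closed segre_pred.
Proof. exact: lspan_submod_closed. Qed.

HB.instance Definition _ := GRing.isZmodClosed.Build (tensor V) segre_pred
  (GRing.submod_closedB segre_submod_closed).
End Span.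

Section Map2.
Variables (U V W : I -> lmodType K) (f : forall i, U i -> V i -> W i).
Variables (J1 J2 J3 : Type) (op : J1 -> J2 -> J3).
Variables (D : forall i, J1 -> set (U i)) (E : forall i, J2 -> set (V i)).
Variable (G : forall i, J3 -> set (W i)).
Hypothesis fb : bilinear_family f.
Hypothesis fDE : forall i j k (x : U i) (y : V i),
  D j x -> E k y -> G (op j k) (f x y).

Lemma lspan_tensor_map2 (S1 : set (tensor U)) (S2 : set (tensor V))
    (S3 : set (tensor W)) :
  (forall t u, S1 t -> S2 u -> lspan S3 (tensor_map2 f t u)) ->
  forall t u, lspan S1 t -> lspan S2 u -> lspan S3 (tensor_map2 f t u).
Proof.
have l0 (X Y : lmodType K) (h : X -> Y) : linear h -> h 0 = 0.
  by move=> hl; have := hl (-1) 0 0; rewrite scaler0 addr0 scaleN1r addNr.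
have fl := tensor_map2_linearl fb; have fr := tensor_map2_linearr fb.
move=> S123 t u St Su; elim: St => [|a s t' S1s _ IHt].
  by rewrite (l0 _ _ _ (fl u)); apply: lspan0.
rewrite fl; apply: lspanP => {t' IHt}//.
elim: Su => [|b v u' S2v _ IHu]; first by rewrite (l0 _ _ _ (fr s)); apply: lspan0.
by rewrite fr; apply: lspanP => //; apply: S123.
Qed.

Lemma segre_pure_map2 j k t u : segre_pure D j t -> segre_pure E k u ->
  segre_pure G (op j k) (tensor_map2 f t u).
Proof.
move=> [x Dx ->] [y Ey ->]; rewrite tensor_map2_pure //.
by exists (fun i => f (x i) (y i)) => // i; apply: fDE.
Qed.

Lemma segre_piece_map2 j k t u : segre_piece D j t -> segre_piece E k u ->
  segre_piece G (op j k) (tensor_map2 f t u).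
Proof.
apply: lspan_tensor_map2 => {}t {}u Dt Eu; apply: lspan_mem.
exact: segre_pure_map2.
Qed.

Lemma segre_set_map2 t u : segre_set D t -> segre_set E u ->
  segre_set G (tensor_map2 f t u).
Proof.
apply: lspan_tensor_map2 => {}t {}u [j Dt] [k Eu]; apply: lspan_mem.
by exists (op j k); apply: segre_pure_map2.
Qed.
End Map2.

Section Ring.
Variable R : I -> stdGradedAlg K.

Local Notation tR := (tensor_alg (fun i => R i)).

Definition segre_alg_pred : {pred tR} :=
  @segre_pred (fun i => R i) nat (fun i => @adeg K (R i)).

Fact segre_alg_subring_closed : subring_closed segre_alg_pred.
Proof.
split.
- apply/asboolP/lspan_mem; exists 0%N; exists (fun i => 1) => // i.
  by apply/adeg0P; exists 1; rewrite scale1r.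
- by move=> s t; apply: (GRing.submod_closedB (segre_submod_closed _)).2.
move=> s t /asboolP Ss /asboolP St; apply/asboolP.
apply: (segre_set_map2 (mul_bilinear (fun i => R i)) (op := addn) _ Ss St).
by move=> i j k x y; apply: adegM.
Qed.
HB.instance Definition _ :=
  GRing.isSubringClosed.Build tR segre_alg_pred segre_alg_subring_closed.

Record segre_alg : Type := SegreAlg {
  segre_alg_val : tR;
  _ : segre_alg_val \in segre_alg_pred
}.
HB.instance Definition _ := [isSub for segre_alg_val].
HB.instance Definition _ := [Choice of segre_alg by <:].
HB.instance Definition _ := GRing.SubChoice_isSubComPzRing.Build tR segre_alg_pred segre_alg
  segre_alg_subring_closed.

Definition segre_alg_deg (n : nat) : set segre_alg :=
  [set a | segre_piece (fun i => @adeg K (R i)) n (val a)].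
End Ring.

Section Module.
Variables (R : I -> stdGradedAlg K) (M : forall i, gradedMod (R i)).

Local Notation tR := (tensor_alg (fun i => R i)).
Local Notation fM := (fun i => restrict_scalars (M i) : lmodType K).
Local Notation tM := (tensor fM).
Local Notation degM := (fun i => @mdeg K (R i) (M i)).

Definition tensor_act : tR -> tM -> tM :=
  @tensor_map2 K I (fun i => R i) fM fM (fun i (a : R i) (x : M i) => a *: x).

Lemma act_bilinear : @bilinear_family K I (fun i => R i) fM fM
  (fun i (a : R i) (x : M i) => a *: x).
Proof.
move=> i; split=> [x|a] b u v /=.
  by rewrite scalerDl restrict_scalarsE scalerA mulr_algl.
by rewrite scalerDr !restrict_scalarsE !scalerA mulrC.
Qed.

Definition segre_mod_pred : {pred tM} :=
  @segre_pred fM int degM.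

HB.instance Definition _ := GRing.isZmodClosed.Build tM segre_mod_pred
  (GRing.submod_closedB (segre_submod_closed _)).

Record segre_mod : Type := SegreMod {
  segre_mod_val : tM;
  _ : segre_mod_val \in segre_mod_pred
}.
HB.instance Definition _ := [isSub for segre_mod_val].
HB.instance Definition _ := [Choice of segre_mod by <:].
HB.instance Definition _ := [SubChoice_isSubZmodule of segre_mod by <:].

Lemma segre_act_subproof (a : segre_alg R) (x : segre_mod) :
  tensor_act (val a) (val x) \in segre_mod_pred.
Proof.
apply/asboolP; apply: (segre_set_map2 act_bilinear (op := fun n j => Posz n + j)).
- by move=> i j k b y; apply: mdegZ.
- exact/asboolP/(valP a).
- exact/asboolP/(valP x).
Qed.

Definition segre_act (a : segre_alg R) (x : segre_mod) : segre_mod :=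
  Sub (tensor_act (val a) (val x)) (segre_act_subproof a x).

Let actl := tensor_map2_linearl act_bilinear.
Let actr := tensor_map2_linearr act_bilinear.
Let mull := tensor_map2_linearl (mul_bilinear (fun i => R i)).
Let mulr := tensor_map2_linearr (mul_bilinear (fun i => R i)).

Lemma tensor_actA a b x : tensor_act a (tensor_act b x) = tensor_act (a * b) x.
Proof.
move: a b x; apply: tensor_ext3.
- by move=> u v c s t; apply: actl.
- by move=> u v c s t; rewrite [X in tensor_act X]mull; apply: actl.
- by move=> u v c s t; rewrite /tensor_act actl actr.
- by move=> u v c s t; rewrite [X in tensor_act X]mulr; apply: actl.
- by move=> u v c s t; rewrite /tensor_act !actr.
- by move=> u v c s t; apply: actr.
move=> x y z; have -> : (pure x : tR) * pure y = pure (fun i => x i * y i : R i).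
  exact: tensor_mul_pure.
rewrite /tensor_act !(tensor_map2_pure act_bilinear); congr pure.
by apply/functional_extensionality_dep => i; exact: (scalerA (x i) (y i) (z i : M i)).
Qed.

Fact segre_actA a b x : segre_act a (segre_act b x) = segre_act (a * b) x.
Proof. by apply: val_inj; rewrite /= tensor_actA. Qed.

Lemma tensor_act1 : left_id 1 tensor_act.
Proof.
apply: tensor_ext => [||x]; first exact: actr.
  by [].
rewrite [LHS](tensor_map2_pure act_bilinear); congr pure.
by apply/functional_extensionality_dep => i; exact: (scale1r (x i : M i)).
Qed.

Fact segre_act1 : left_id 1 segre_act.
Proof. by move=> x; apply: val_inj; rewrite /= tensor_act1. Qed.

Fact segre_actDr : right_distributive segre_act +%R.
Proof.
move=> a x y; apply: val_inj => /=.
by have := actr (val a) 1 (val x) (val y); rewrite /= !scale1r.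
Qed.

Fact segre_actDl x : {morph segre_act^~ x : a b / a + b}.
Proof.
move=> a b; apply: val_inj => /=.
by have := actl (val x) 1 (val a) (val b); rewrite /= !scale1r.
Qed.

HB.instance Definition _ := GRing.Zmodule_isLmodule.Build (segre_alg R) segre_mod
  segre_actA segre_act1 segre_actDr segre_actDl.

Definition segre_mod_deg (j : int) : set segre_mod :=
  [set x | @segre_piece fM int degM j (val x)].
End Module.

Section Alpha.
Variables (R : I -> stdGradedAlg K) (M : forall i, fgGradedMod (R i)).

Local Notation T := (segre_alg R).
Local Notation tR := (tensor_alg (fun i => R i)).
Local Notation fM := (fun i => restrict_scalars (M i) : lmodType K).
Local Notation fD := (fun i => restrict_scalars (dual_gmod (M i)) : lmodType K).

(* [segre_dual] is M_1^* # ... # M_m^* and [dual_segre] is (M_1 # ... # M_m)^*,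
   both modules over T = R_1 # ... # R_m. *)
Definition segre_dual : Type := segre_mod (fun i => dual_gmod (M i)).
HB.instance Definition _ := GRing.Lmodule.on segre_dual.
Definition dual_segre : Type := dual (segre_mod (fun i => M i)).
HB.instance Definition _ := GRing.Lmodule.on dual_segre.

Definition tensor_eval : tensor fD -> tensor fM -> tR :=
  @tensor_map2 K I fD fM (fun i => R i) (fun i (f : dual (M i)) (x : M i) => f x).

Lemma eval_bilinear : @bilinear_family K I fD fM (fun i => R i)
  (fun i (f : dual (M i)) (x : M i) => f x).
Proof.
move=> i; split=> [x|f] a u v; first by rewrite -[in RHS]mulr_algl.
rewrite -[in RHS]mulr_algl; exact: (linearP (f : dual (M i)) a%:A u v).
Qed.

Lemma tensor_eval_pure (f : forall i, dual (M i)) (x : forall i, M i) :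
  tensor_eval (@pure K I fD f) (@pure K I fM x) = @pure K I (fun i => R i) (fun i => f i (x i)).
Proof. exact: (tensor_map2_pure eval_bilinear). Qed.

Lemma segre_set_int_degree (t : tR) :
  @segre_set (fun i => R i) int (fun i => int_degree (@adeg K (R i))) t ->
  @segre_set (fun i => R i) nat (fun i => @adeg K (R i)) t.
Proof.
apply: lspan_sub => u [[n|n] [x Dx ->]]; first by exists n, x.
exists 0%N, x => // i; rewrite (Dx i).
exact: (grading0 (@adeg_grading K (R i))).
Qed.

Lemma alpha_subproof (t : segre_dual) (x : segre_mod (fun i => M i)) :
  tensor_eval (val t) (val x) \in segre_alg_pred (R := R).
Proof.
apply/asboolP/segre_set_int_degree.
apply: (@segre_set_map2 fD fM (fun i => R i) _ int int int (fun j k => k + j)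
  (fun i => @mdeg K (R i) (dual_gmod (M i))) (fun i => @mdeg K (R i) (M i))
  (fun i => int_degree (@adeg K (R i))) eval_bilinear).
- move=> i j k f y Df Dy. exact: (Df k y Dy).
- exact/asboolP/(valP t).
- exact/asboolP/(valP x).
Qed.

Definition alpha_fun (t : segre_dual) (x : segre_mod (fun i => M i)) : T :=
  Sub (tensor_eval (val t) (val x)) (alpha_subproof t x).

Let evl := tensor_map2_linearl eval_bilinear.
Let evr := tensor_map2_linearr eval_bilinear.

Let actMl := tensor_map2_linearl (act_bilinear (fun i => M i)).
Let actMr := tensor_map2_linearr (act_bilinear (fun i => M i)).
Let actDl := tensor_map2_linearl (act_bilinear (fun i => dual_gmod (M i))).
Let actDr := tensor_map2_linearr (act_bilinear (fun i => dual_gmod (M i))).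
Let mull := tensor_map2_linearl (mul_bilinear (fun i => R i)).
Let mulr := tensor_map2_linearr (mul_bilinear (fun i => R i)).

Lemma tensor_eval_act (a : tR) (t : tensor fD) (x : tensor fM) :
  tensor_eval t (tensor_act a x) = a * tensor_eval t x.
Proof.
move: a t x; apply: (@tensor_ext3 K I (fun i => R i) fD fM
  (tensor (fun i => R i) : lmodType K)
  (fun a t x => tensor_eval t (tensor_act a x))
  (fun a t x => tensor_mul a (tensor_eval t x))).
- by move=> t x b u v; rewrite /tensor_act actMl /tensor_eval evr.
- by move=> t x b u v; apply: mull.
- by move=> a x b u v; apply: evl.
- by move=> a x b u v; rewrite /tensor_eval evl /tensor_mul mulr.
- by move=> a t b u v; rewrite /tensor_act actMr /tensor_eval evr.
- by move=> a t b u v; rewrite /tensor_eval evr /tensor_mul mulr.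
move=> a f x; rewrite tensor_eval_pure.
rewrite [tensor_act _ _](tensor_map2_pure (act_bilinear (fun i => M i))).
rewrite tensor_eval_pure [RHS](tensor_map2_pure (mul_bilinear (fun i => R i))).
congr pure; apply/functional_extensionality_dep => i.
exact: (linearZZ (f i : dual (M i)) (a i) (x i : M i)).
Qed.

Lemma tensor_act_eval (a : tR) (t : tensor fD) (x : tensor fM) :
  tensor_eval (tensor_act a t) x = a * tensor_eval t x.
Proof.
move: a t x; apply: (@tensor_ext3 K I (fun i => R i) fD fM
  (tensor (fun i => R i) : lmodType K)
  (fun a t x => tensor_eval (tensor_act a t) x)
  (fun a t x => tensor_mul a (tensor_eval t x))).
- by move=> t x b u v; rewrite /tensor_act actDl /tensor_eval evl.
- by move=> t x b u v; apply: mull.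
- by move=> a x b u v; rewrite /tensor_act actDr /tensor_eval evl.
- by move=> a x b u v; rewrite /tensor_eval evl /tensor_mul mulr.
- by move=> a t b u v; apply: evr.
- by move=> a t b u v; rewrite /tensor_eval evr /tensor_mul mulr.
move=> a f x; rewrite tensor_eval_pure.
rewrite [tensor_act _ _](tensor_map2_pure (act_bilinear (fun i => dual_gmod (M i)))).
by rewrite tensor_eval_pure [RHS](tensor_map2_pure (mul_bilinear (fun i => R i))).
Qed.

Lemma tensor_evalDr t : {morph tensor_eval t : x y / x + y}.
Proof. by move=> x y; have := evr t 1 x y; rewrite !scale1r. Qed.

Lemma tensor_evalDl x : {morph tensor_eval^~ x : t u / t + u}.
Proof. by move=> t u; have := evl x 1 t u; rewrite /= !scale1r. Qed.

Lemma alpha_fun_linear t : linear (alpha_fun t : _ -> T^o).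
Proof.
move=> a x y; apply: val_inj; rewrite /= tensor_evalDr; congr (_ + _).
exact: tensor_eval_act.
Qed.

(* The natural map, characterised by [alpha_pure]. *)
Definition alpha (t : segre_dual) : dual_segre :=
  HB.pack (alpha_fun t : _ -> T^o)
    (GRing.isLinear.Build T _ T^o *:%R (alpha_fun t : _ -> T^o) (alpha_fun_linear t)).

Lemma alphaE t x : val (alpha t x) = tensor_eval (val t) (val x).
Proof. by []. Qed.

Lemma alpha_pure (t : segre_dual) (x : segre_mod (fun i => M i))
    (f : forall i, dual (M i)) (y : forall i, M i) :
  val t = @pure K I fD f -> val x = @pure K I fM y ->
  val (alpha t x) = @pure K I (fun i => R i) (fun i => f i (y i)).
Proof. by move=> tE xE; rewrite alphaE tE xE tensor_eval_pure. Qed.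

Lemma alpha_linear : linear alpha.
Proof.
move=> a t u; apply: dualP => x; apply: val_inj; rewrite /= tensor_evalDl.
congr (_ + _); exact: tensor_act_eval.
Qed.
HB.instance Definition _ := GRing.isLinear.Build T segre_dual dual_segre *:%R alpha alpha_linear.
End Alpha.

Section SegreGrading.
Variables (V : I -> lmodType K) (J : choiceType) (D : forall i, J -> set (V i)).
Hypotheses (gD : forall i, is_grading (@D i)) (i0 : I).
Hypothesis DZ : forall i j (a : K) (x : V i), D j x -> D j (a *: x).

Lemma hcompZ i j (a : K) (x : V i) :
  hcomp (@D i) (a *: x) j = a *: hcomp (@D i) x j.
Proof.
have [s us xs] := hcomp_finite (gD i) x.
apply: (@hcomp_eq _ _ _ (gD i) _ (fun j => a *: hcomp (@D i) x j) s us) => [k|k /xs->|].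
- by apply: DZ; apply: hcomp_deg (gD i) _ _.
- by rewrite scaler0.
- by rewrite -scaler_sumr -hcomp_sum.
Qed.

Definition segre_proj (j : J) : tensor V -> tensor V :=
  tensor_lift (fun x : forall i, V i => pure (fun i => hcomp (@D i) (x i) j)).

Let proj_multilinear (j : J) :
  multilinear (fun x : forall i, V i => pure (fun i => hcomp (@D i) (x i) j)).
Proof.
move=> x i a u v.
have E w : (fun k => hcomp (@D k) (dfwith x w k) j) =
           dfwith (fun k => hcomp (@D k) (x k) j) (hcomp (@D i) w j).
  apply/functional_extensionality_dep => k.
  by case: dfwithP => [|l il]; rewrite ?dfwith_in ?dfwith_out.
by rewrite !E hcompD // hcompZ pure_multilinear.
Qed.

Let proj_linear j : linear (segre_proj j).
Proof. exact/tensor_lift_linear/proj_multilinear. Qed.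

Let proj_pure j x : segre_proj j (pure x) = pure (fun i => hcomp (@D i) (x i) j).
Proof. exact/tensor_lift_pure/proj_multilinear. Qed.

Let linear_0 (f : tensor V -> tensor V) : linear f -> f 0 = 0.
Proof. by move=> fl; have := fl (-1) 0 0; rewrite scaler0 addr0 scaleN1r addNr. Qed.

Lemma pure_eq0 (x : forall i, V i) i : x i = 0 -> pure x = 0.
Proof.
move=> xi0; have := pure_multilinear x (-1) (x i) (x i).
rewrite !scaleN1r !addNr => <-; congr pure.
by apply/functional_extensionality_dep => k; case: dfwithP.
Qed.

Lemma segre_proj_piece j t : segre_piece D j (segre_proj j t).
Proof.
elim/tensor_ind: t => [|a x t IH].
  by rewrite (linear_0 (proj_linear j)); apply: lspan0.
rewrite proj_linear proj_pure; apply: lspanZD => //.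
by exists (fun i => hcomp (@D i) (x i) j) => // i; apply: hcomp_deg.
Qed.

Lemma segre_proj_id j k t : segre_piece D k t ->
  segre_proj j t = if j == k then t else 0.
Proof.
elim=> [|a _ t' [x Dx ->] _ IH].
  by rewrite (linear_0 (proj_linear j)) if_same.
rewrite proj_linear IH proj_pure; case: eqVneq => [->|jk].
  congr (_ *: pure _ + _); apply/functional_extensionality_dep => i.
  by rewrite (hcomp_hom (gD i) k (Dx i)) eqxx.
rewrite (@pure_eq0 _ i0) ?scaler0 ?addr0 //.
by rewrite (hcomp_hom (gD i0) j (Dx i0)) (negPf jk).
Qed.

Lemma segre_proj_sum t : segre_set D t -> exists2 s : seq J, uniq s &
  (forall j, j \notin s -> segre_proj j t = 0) /\
  t = \sum_(j <- s) segre_proj j t.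
Proof.
elim=> [|a _ t' [k [x Dx ->]] _ [s us [s0 sE]]].
  exists [::] => //; split; last by rewrite big_nil.
  by move=> j _; rewrite (linear_0 (proj_linear j)).
have pk : segre_piece D k (pure x) by apply: lspan_mem; exists x.
have us' := undup_uniq (k :: s).
exists (undup (k :: s)) => //; split.
  move=> j; rewrite mem_undup inE negb_or => /andP[jk js].
  by rewrite proj_linear (segre_proj_id j pk) (negPf jk) scaler0 add0r s0.
under eq_bigr => j _ do rewrite proj_linear (segre_proj_id j pk).
rewrite big_split /= -scaler_sumr; congr (_ *: _ + _).
  rewrite -big_mkcond -big_filter filter_pred1_uniq ?big_seq1 //.
  by case: ifP => ks; rewrite ?mem_undup ?inE ?ks ?eqxx.
rewrite undup_id //; case: ifP => ks; first exact: sE.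
by rewrite big_cons (s0 k) ?ks // add0r; exact: sE.
Qed.

Lemma segre_grading (S : zmodType) (v : {additive S -> tensor V}) :
  injective v -> (forall x, segre_set D (v x)) ->
  (forall t, segre_set D t -> exists x, v x = t) ->
  is_grading (fun j => [set x : S | segre_piece D j (v x)]).
Proof.
move=> v_inj vS /= v_surj; split=> [j|x].
  split=> [|x y Dx Dy] /=; first by rewrite raddf0; apply: lspan0.
  by rewrite raddfB addrC -scaleN1r; apply: lspanP.
have /choice[c cE] : forall j, exists y, v y = segre_proj j (v x).
  move=> j; apply: v_surj; apply: lspan_sub (segre_proj_piece j (v x)).
  by move=> t Dt; exists j.
have [s us [s0 sE]] := segre_proj_sum (vS x).
exists c; split.
  apply: (homogeneous_decomposition_seq us) => [j|j js|].
  - by rewrite /= cE; apply: segre_proj_piece.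
  - by apply: v_inj; rewrite raddf0 cE s0.
  - by apply: v_inj; rewrite {1}sE raddf_sum; apply: eq_bigr => j _.
move=> c' [Dc' /finite_seqP[t tE] xE]; apply/funext => j; apply: v_inj.
have t0 k : k \notin undup t -> c' k = 0.
  rewrite mem_undup => kt; apply/eqP; apply: contraNT kt => ck.
  by have : [set` t] k by rewrite -tE.
rewrite cE xE (fsum_seq (undup_uniq t) t0) raddf_sum.
have pD : {morph segre_proj j : a b / a + b}.
  by move=> a b; have := proj_linear j 1 a b; rewrite !scale1r.
rewrite (big_morph _ pD (linear_0 (proj_linear j))).
under eq_bigr => k _ do rewrite (segre_proj_id j (Dc' k)) eq_sym.
have [jt|/[dup] jt /t0 c'0] := boolP (j \in undup t).
  rewrite (bigD1_seq j) ?undup_uniq //= eqxx big1 ?addr0 // => k /negPf jk.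
  by rewrite jk.
rewrite c'0 raddf0 big_seq big1 // => k kt; case: eqP => // kj.
by rewrite kj (negPf jt) in kt.
Qed.
End SegreGrading.

Lemma segre_alg_grading (R : I -> stdGradedAlg K) (i0 : I) :
  is_grading (@segre_alg_deg R).
Proof.
apply: (@segre_grading (fun i => R i) nat (fun i => @adeg K (R i)) _ i0 _
  (segre_alg R) (val : segre_alg R -> tensor (fun i => R i))).
- by move=> i; apply: adeg_grading.
- move=> i j a x Dx; rewrite -mulr_algl -[j]add0n; apply: adegM => //.
  by apply/adeg0P; exists a.
- exact: val_inj.
- by move=> x; apply/asboolP/(valP x).
- by move=> t /asboolP tS; exists (SegreAlg tS).
Qed.

Lemma segre_mod_grading (R : I -> stdGradedAlg K) (M : forall i, gradedMod (R i))
  (i0 : I) : is_grading (@segre_mod_deg R M).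
Proof.
apply: (@segre_grading (fun i => restrict_scalars (M i)) int
  (fun i => @mdeg K (R i) (M i)) _ i0 _ (segre_mod M)
  (val : segre_mod M -> tensor (fun i => restrict_scalars (M i) : lmodType K))).
- by move=> i; apply: mdeg_grading.
- move=> i j a x Dx; rewrite -[j]add0r; apply: mdegZ => //.
  by apply/adeg0P; exists a.
- exact: val_inj.
- by move=> x; apply/asboolP/(valP x).
- by move=> t /asboolP tS; exists (SegreMod tS).
Qed.
End Segre.

Definition graded_isomorphism (A : pzRingType) (U V : lmodType A)
    (degU : int -> set U) (degV : int -> set V) (f : {linear U -> V}) : Prop :=
  bijective f /\ forall j u, degU j u <-> degV j (f u).

Arguments alpha {K I R} M t.

Section Main.
Variables (K : fieldType) (I : finType) (R : I -> stdGradedAlg K).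

Definition segre_dual_deg (M : forall i, fgGradedMod (R i)) :
    int -> set (segre_dual M) :=
  @segre_mod_deg K I R (fun i => dual_gmod (M i)).

Definition dual_segre_deg (M : forall i, fgGradedMod (R i)) :
    int -> set (dual_segre M) :=
  dual_deg (int_degree (@segre_alg_deg K I R))
           (@segre_mod_deg K I R (fun i => M i)).

Definition natural_map_iso (M : forall i, fgGradedMod (R i)) : Prop :=
  graded_isomorphism (@segre_dual_deg M) (@dual_segre_deg M) (alpha M).

Definition friendly : Prop :=
  forall a : I -> int,
    natural_map_iso (fun i => shift (regular_fgmod (R i)) (a i)).
End Main.
Arguments segre_dual_deg {K I R} M j _.
Arguments dual_segre_deg {K I R} M i _.

(* Main.v *)
From HB Require Import structures.
Require Import Defs.
From mathcomp Require Import all_boot all_order all_algebra.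
From mathcomp Require Import boolp classical_sets functions fsbigop.

(** The natural map alpha is evaluation: an element t of the tensor product of the
    duals of the M i takes a value t(x) in the tensor product of the R i at each
    tuple x = (x_1, ..., x_m).  A T-linear map f on the Segre product of the M i only
    has values at tuples whose entries share one degree.  Friendliness recovers
    the missing values.  If x_i is homogeneous of degree d i, then
    r |-> f (r_1 x_1 (x) ... (x) r_m x_m) is a T-linear map from the Segre product
    of the R i (- d i) to T, hence multiplication by an element s(x) of the Segre
    product of the R i (d i) ([friendly_surj]), and s(x) is unique
    ([friendly_inj]).

    Injectivity of alpha follows from uniqueness: if alpha t = 0, all values of t
    at homogeneous tuples vanish, and a tensor of dual maps is determined by
    these values ([tensor_dual_eq0]).

    For surjectivity, uniqueness makes s multilinear over the rings R i
    ([lift_slot_add], [lift_slot_scale]).  It remains to see that a map which is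
    multilinear over the R i, on finitely generated modules, comes from the tensor
    product of the duals.  Expanding on generators exhibits s as a tensor of
    arbitrary functions ([interpolation]).  Every slice of this tensor, obtained by
    applying functionals in all slots but one, is linear over the remaining R i,
    and over a field a tensor whose slices lie in given subspaces is a tensor of
    elements of these subspaces ([pure_span_slices]).  Projecting to the
    components of equal degree lands in the Segre product of the duals.  Working
    with values instead of a presentation of the M i avoids any exactness
    argument.

    Finally alpha maps degree j to degree j by construction; conversely, if
    alpha t is homogeneous, the other components of t are killed by alpha, which
    is injective. *)

Set Implicit Arguments.
Unset Strict Implicit.
Unset Printing Implicit Defensive.

Import GRing.Theory.
Local Open Scope classical_set_scope.
Local Open Scope ring_scope.

(** * Linear algebra over a field: functionals and finite-rank operators *)

Section LinearSpan.
Variables (K : fieldType) (V W : lmodType K).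

Lemma linear_fun0 (f : V -> W) : linear f -> f 0 = 0.
Proof. by move=> fl; have := fl (-1) 0 0; rewrite scaler0 addr0 scaleN1r addNr. Qed.

Lemma linear_funD (f : V -> W) : linear f -> {morph f : x y / x + y}.
Proof. by move=> fl x y; have := fl 1 x y; rewrite !scale1r. Qed.

Lemma linear_funZ (f : V -> W) : linear f -> forall a, {morph f : x / a *: x}.
Proof.
by move=> fl a x; have := fl a x 0; rewrite !addr0 (linear_fun0 fl) addr0.
Qed.

Lemma linear_fun_sum (f : V -> W) : linear f ->
  forall J (s : seq J) (P : pred J) (F : J -> V),
  f (\sum_(j <- s | P j) F j) = \sum_(j <- s | P j) f (F j).
Proof.
by move=> fl J s P F; apply: (big_morph f (linear_funD fl) (linear_fun0 fl)).
Qed.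

Lemma lspan_linear (f : V -> W) (S : set V) (S' : set W) : linear f ->
  (forall x, S x -> lspan S' (f x)) -> forall x, lspan S x -> lspan S' (f x).
Proof.
move=> fl fS x; elim=> [|a u v Su _ IH]; first by rewrite (linear_fun0 fl); apply: lspan0.
by rewrite fl; apply: lspanP => //; apply: fS.
Qed.

End LinearSpan.

Lemma lspanD (K : pzRingType) (V : lmodType K) (S : set V) x y :
  lspan S x -> lspan S y -> lspan S (x + y).
Proof. by move=> Sx Sy; rewrite -[x]scale1r; apply: lspanP. Qed.

Lemma lspanZ (K : pzRingType) (V : lmodType K) (S : set V) a x :
  lspan S x -> lspan S (a *: x).
Proof. by move=> Sx; rewrite -[_ *: _]addr0; apply: lspanP => //; apply: lspan0. Qed.

Lemma lspan_sum (K : pzRingType) (V : lmodType K) (S : set V)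
    (J : Type) (s : seq J) (P : pred J) (F : J -> V) :
  (forall j, P j -> lspan S (F j)) -> lspan S (\sum_(j <- s | P j) F j).
Proof.
by move=> SF; apply: big_ind => //; [exact: lspan0 | exact: lspanD].
Qed.

Section FunctionalsSeparate.
Variables (K : fieldType) (V : lmodType K).

(** A subspace A maximal among those avoiding v0 (Zorn) is a hyperplane
    complementary to the line K v0: if v is not in A, then v0 lies in A + K v by
    maximality, and so v lies in A + K v0.  The functional is the coordinate
    along v0.  The statement is needed for the rings R i, which can be infinite
    dimensional. *)
Lemma functionals_separate (v0 : V) : v0 != 0 ->
  exists f : V -> K, linear (f : V -> K^o) /\ f v0 != 0.
Proof.
move=> v0n.
pose closed (A : set V) := forall a x y, A x -> A y -> A (a *: x + y).
(* [closed] does not force 0 \in A, so that the empty chain has the empty set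
   as an upper bound. *)
have [|A [[Ac Av0] maxA]] := @Zorn_bigcup V (fun A => closed A /\ ~ A v0).
  move=> F FP totF; split; last by move=> [A /FP[]].
  move=> a x y [A FA Ax] [B FB By].
  have [AB|BA] := totF _ _ FA FB.
    by exists B => //; apply: (FP _ FB).1 => //; apply: AB.
  by exists A => //; apply: (FP _ FA).1 => //; apply: BA.
have A0 : A 0.
  apply: contrapT => nA0; apply: (maxA [set 0]).
    split=> [|/(_ 0 erefl)//]; move=> x Ax; case: nA0.
    by have := Ac (-1) x x Ax Ax; rewrite scaleN1r addNr.
  split=> [a x y -> ->|/eqP]; first by rewrite scaler0 addr0.
  exact/negP.
have AZ a x : A x -> A (a *: x) by move=> Ax; rewrite -[_ *: _]addr0; apply: Ac.
have AB x y : A x -> A y -> A (x - y).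
  by move=> Ax Ay; rewrite addrC -scaleN1r; apply: Ac.
have /choice[f fP] : forall v, exists c : K, A (v - c *: v0).
  move=> v; have [Av|nAv] := pselect (A v); first by exists 0; rewrite scale0r subr0.
  pose B : set V := [set w | exists a u, A u /\ w = a *: v + u].
  have [[a [u [Au v0E]]]|nB] := pselect (B v0).
    have a0 : a != 0.
      by apply/eqP => a0; apply: Av0; rewrite v0E a0 scale0r add0r.
    exists a^-1; rewrite v0E scalerDr scalerA mulVf // scale1r opprD addNKr.
    by rewrite -scaleNr; apply: AZ.
  case: (maxA B).
    split=> [|BA]; last by apply/nAv/BA; exists 1, 0; rewrite scale1r addr0.
    by move=> u Au; exists 0, u; rewrite scale0r add0r.
  split=> // a x y [b [u [Au ->]]] [c [w [Aw ->]]].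
  exists (a * b + c), (a *: u + w); split; first exact: Ac.
  by rewrite scalerDr scalerDl scalerA addrACA.
have fU v c : A (v - c *: v0) -> f v = c.
  move=> Ac'; apply/eqP; apply: contraTT isT => ne; case: Av0.
  have := AZ (f v - c)^-1 _ (AB _ _ Ac' (fP v)).
  have -> : v - c *: v0 - (v - f v *: v0) = (f v - c) *: v0.
    by rewrite opprB addrC addrA subrK scalerBl.
  by rewrite scalerA mulVf ?scale1r // subr_eq0.
exists f; split.
  move=> a x y; apply: fU; rewrite scalerDl opprD addrACA -scalerA -scalerBr.
  exact: Ac.
by rewrite (fU _ 1) ?oner_neq0 // scale1r subrr.
Qed.
End FunctionalsSeparate.

Section FiniteRank.
Variables (K : fieldType) (V : lmodType K).

Definition separating (L : set (V -> K)) : Prop :=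
  forall v, v != 0 -> exists2 f, L f & f v != 0.

Definition rank_one (L : set (V -> K)) (N : set V) : set (V -> V) :=
  [set g | exists f w, [/\ L f, N w & g = fun v => f v *: w]].

Variables (L : set (V -> K)).
Hypothesis L_linear : forall f, L f -> linear (f : V -> K^o).
Hypothesis L_separating : separating L.

(** If q is the identity on s but q v != v, then v - q v is a nonzero vector, a
    functional f of L detects it, and f \o (1 - q) is a combination of
    functionals of L that kills s but not v: this adds one rank-one term to q.
    Keeping the values of q inside N is what later allows one slot of a tensor
    to be treated without disturbing the slots already treated. *)
Lemma finite_rank_identity (N : set V) (s : seq V) :
  N 0 -> (forall a x y, N x -> N y -> N (a *: x + y)) ->
  (forall v, v \in s -> N v) ->
  exists2 q : V -> V, lspan (rank_one L N) q & forall v, v \in s -> q v = v.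
Proof.
move=> N0 NP; elim: s => [|v s IH] sN.
  by exists 0 => //; apply: lspan0.
have [|q qL qs] := IH; first by move=> w ws; apply: sN; rewrite inE ws orbT.
have qlin : linear q.
  elim: qL => [|a _ h [f [w [/L_linear fl _ ->]]] _ IHh] b x y.
    by rewrite -[RHS]/(b *: 0 + 0 : V) scaler0 addr0.
  have fE : f (b *: x + y) = b * f x + f y by apply: fl.
  rewrite -![(_ + h) _]/(_ + h _) IHh.
  rewrite -![(_ *: (fun _ => _)) _]/(_ *: (_ *: _)) fE !scalerDl !scalerDr !scalerA.
  by rewrite mulrCA mulrA addrACA.
have qN x : N (q x).
  elim: qL => [|a _ h [f [w [_ Nw ->]]] _ IHh] //.
  by apply: (NP) => //; rewrite -[_ *: w]addr0; apply: NP.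
have [qv|qv] := eqVneq (q v) v.
  by exists q => // w; rewrite inE => /predU1P[->|/qs].
have [|f Lf fv] := L_separating (v := v - q v); first by rewrite subr_eq0 eq_sym.
have Nv : N (v - q v).
  by rewrite addrC -scaleN1r; apply: NP => //; apply: sN; rewrite inE eqxx.
have fl := L_linear Lf.
have fB x y : f (x - y) = f x - f y.
  by rewrite -[x - y]addrC -scaleN1r fl [LHS]addrC -[_ *: _]/(_ * _) mulN1r.
have fE a x y : f (a *: x + y) = a * f x + f y by apply: fl.
have fqL : lspan (rank_one L N) (fun z => f (q z) *: (v - q v)).
  move: (v - q v) Nv => e Ne.
  elim: (qL) => [|a _ h [f' [w [Lf' _ ->]]] _ IHh].
    set g := (X in lspan _ X); have -> : g = 0; last exact: lspan0.
    apply/funext => z.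
    exact: (etrans (congr1 (fun c => c *: e) (linear_fun0 fl)) (scale0r e)).
  set g := (X in lspan _ X).
  have -> : g = (a * f w) *: (fun z => f' z *: e) + (fun z => f (h z) *: e).
    apply/funext => z; rewrite /g.
    rewrite -[((a * f w) *: _ + _) z]/((a * f w) *: (f' z *: e) + _).
    rewrite -[(a *: _ + h) z]/(a *: (f' z *: w) + h z).
    by rewrite scalerA fE scalerDl scalerA mulrAC.
  by apply: lspanP => //; apply: lspan_mem; exists f', e.
exists (q + (f (v - q v))^-1 *: ((fun z => f z *: (v - q v))
              - (fun z => f (q z) *: (v - q v)))).
  apply: lspanD => //; apply: lspanZ; apply: lspanD.
    by apply: lspan_mem; exists f, (v - q v).
  by have := lspanZ (-1) fqL; rewrite scaleN1r.
move=> w.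
rewrite -[(q + _) w]/(q w + (f (v - q v))^-1 *:
  (f w *: (v - q v) - f (q w) *: (v - q v))).
rewrite -scalerBl -fB inE => /predU1P[->|/qs->].
  by rewrite scalerA mulVf // scale1r addrC subrK.
by rewrite subrr (linear_fun0 fl) scale0r scaler0 addr0.
Qed.
End FiniteRank.

Section MultilinearSpan.
Variables (K : fieldType) (I : finType) (V : I -> lmodType K) (W : lmodType K).
Variables (F : (forall i, V i) -> W).
Hypothesis Fm : multilinear F.

Lemma dfwith_id (T : I -> Type) (x : forall i, T i) i : dfwith x (x i) = x.
Proof. by apply/functional_extensionality_dep => k; case: dfwithP. Qed.

Lemma multilinear0 x i : x i = 0 -> F x = 0.
Proof.
move=> xi0; have := Fm x (-1) (x i) (x i).
by rewrite !scaleN1r !addNr -{1}xi0 dfwith_id.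
Qed.

(** The slots are moved from generators to their span one at a time. *)
Lemma multilinear_span (S : forall i, set (V i)) (X : set W) :
  (forall x, (forall i, S i (x i)) -> lspan X (F x)) ->
  forall x, (forall i, lspan (S i) (x i)) -> lspan X (F x).
Proof.
move=> FS x Sx.
suff H (P : seq I) (y : forall i, V i) : (forall i, i \in P -> lspan (S i) (y i)) ->
    (forall i, i \notin P -> S i (y i)) -> lspan X (F y).
  by apply: (H (enum I)) => i; rewrite mem_enum.
elim: P y {x Sx} => [|i P IH] y yP ynP; first by apply: FS => i; apply: ynP.
rewrite -(dfwith_id y i).
have yi : lspan (S i) (y i) by apply: yP; rewrite inE eqxx.
elim: yi => [|a u v Su _ IHv].
  by rewrite (@multilinear0 _ i) ?dfwith_in //; apply: lspan0.
rewrite Fm; apply: lspanP => //; apply: IH => j.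
  by case: dfwithP => [|k ik] kP; [apply: lspan_mem | apply: yP; rewrite inE kP orbT].
case: dfwithP => // k ik kP; apply: ynP; rewrite inE negb_or kP andbT.
by rewrite eq_sym.
Qed.

Lemma multilinear_scale (c : I -> K) (x : forall i, V i) :
  F (fun i => c i *: x i) = (\prod_i c i) *: F x.
Proof.
suff H (P : seq I) : uniq P ->
    F (fun i => if i \in P then c i *: x i else x i) = (\prod_(i <- P) c i) *: F x.
  rewrite -big_enum -H ?enum_uniq //; congr F.
  by apply/functional_extensionality_dep => i; rewrite mem_enum.
elim: P => [_|i P IH /= /andP[iP uP]]; first by rewrite big_nil scale1r.
rewrite big_cons -scalerA -IH // => {IH}.
set y := (X in _ = _ *: F X).
have yi : y i = x i by rewrite /y (negPf iP).
have -> : (fun k => if k \in i :: P then c k *: x k else x k) =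
    dfwith y (c i *: y i + 0).
  apply/functional_extensionality_dep => k; case: dfwithP => [|j ij].
    by rewrite inE eqxx addr0 yi.
  by rewrite inE eq_sym (negPf ij).
by rewrite Fm dfwith_id [X in _ + X](@multilinear0 _ i) ?addr0 ?dfwith_in.
Qed.
End MultilinearSpan.

(** * Tensors of linear maps, contractions and slices *)

Lemma family_choice (T : Type) (U : T -> Type) (P : forall i, U i -> Prop) :
  (forall i, exists u, P i u) -> exists f : forall i, U i, forall i, P i (f i).
Proof. by move=> h; exists (fun i => sval (cid (h i))) => i; case: cid. Qed.

Section TensorFunctoriality.
Variables (K : fieldType) (I : finType).

Definition tensor_map (U V : I -> lmodType K) (g : forall i, U i -> V i) :
    tensor U -> tensor V :=
  tensor_lift (fun x => pure (fun i => g i (x i))).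

Lemma dfwith_map (U V : I -> Type) (g : forall i, U i -> V i)
    (x : forall i, U i) i (u : U i) :
  (fun k => g k (dfwith x u k)) = dfwith (fun k => g k (x k)) (g i u).
Proof.
apply/functional_extensionality_dep => k.
by case: dfwithP => [|l il]; rewrite ?dfwith_in ?dfwith_out.
Qed.

Lemma multilinear_comp (U V : I -> lmodType K) (W : lmodType K)
    (g : forall i, U i -> V i) (F : (forall i, V i) -> W) :
  (forall i, linear (g i)) -> multilinear F ->
  multilinear (fun x : forall i, U i => F (fun i => g i (x i))).
Proof. by move=> gl Fm x i a u v; rewrite !dfwith_map gl Fm. Qed.

Lemma multilinear_sum (V : I -> lmodType K) (W : lmodType K) (J : Type)
    (s : seq J) (F : J -> (forall i, V i) -> W) :
  (forall j, multilinear (F j)) -> multilinear (fun x => \sum_(j <- s) F j x).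
Proof.
move=> Fm x i a u v; rewrite scaler_sumr -big_split; apply: eq_bigr => j _.
exact: Fm.
Qed.

Lemma multilinear_linear (V : I -> lmodType K) (W W' : lmodType K)
    (f : W -> W') (F : (forall i, V i) -> W) :
  linear f -> multilinear F -> multilinear (f \o F).
Proof. by move=> fl Fm x i a u v; rewrite /= Fm fl. Qed.

Section Map.
Variables (U V : I -> lmodType K) (g : forall i, U i -> V i).
Hypothesis gl : forall i, linear (@g i).

Let gm := multilinear_comp gl (@pure_multilinear K I V).

Lemma tensor_map_linear : linear (tensor_map (@g)).
Proof. exact: tensor_lift_linear gm. Qed.

Lemma tensor_map_pure x : tensor_map (@g) (pure x) = pure (fun i => @g i (x i)).
Proof. exact: (tensor_lift_pure gm). Qed.
End Map.

Variable V : I -> lmodType K.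

Lemma prod_multilinear (f : forall i, V i -> K) (P : pred I) :
  (forall i, P i -> linear (f i : V i -> K^o)) ->
  forall (x : forall i, V i) i a (u v : V i),
  P i -> \prod_(k | P k) f k (dfwith x (a *: u + v) k) =
  a * \prod_(k | P k) f k (dfwith x u k) + \prod_(k | P k) f k (dfwith x v k).
Proof.
move=> fl x i a u v Pi; rewrite !(bigD1 i Pi) /= !dfwith_in.
have E (w : V i) : \prod_(k | P k && (k != i)) f k (dfwith x w k) =
           \prod_(k | P k && (k != i)) f k (x k).
  by apply: eq_bigr => k /andP[_ ki]; rewrite dfwith_out // eq_sym.
have fE : f i (a *: u + v) = a * f i u + f i v by exact: (fl i Pi a u v).
by rewrite !E fE mulrDl mulrA.
Qed.

Definition tensor_contract (f : forall i, V i -> K) : tensor V -> K :=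
  @tensor_lift K I V K^o (fun x => \prod_i f i (x i) : K^o).

(** Applies the functionals f k in all slots k != i and leaves slot i: a map
    from the tensor product back to its i-th factor. *)
Definition tensor_slice (i : I) (f : forall i, V i -> K) : tensor V -> V i :=
  tensor_lift (fun x => (\prod_(k | k != i) f k (x k)) *: x i).

Section Functionals.
Variable f : forall i, V i -> K.

Section Contract.
Hypothesis fl : forall i, linear (@f i : V i -> K^o).

Let contract_multilinear :
  @multilinear K I V K^o (fun x => \prod_i @f i (x i) : K^o).
Proof. by move=> x i a u v; apply: (prod_multilinear (P := xpredT)). Qed.

Lemma tensor_contract_linear : linear (tensor_contract (@f) : tensor V -> K^o).
Proof. exact: tensor_lift_linear contract_multilinear. Qed.

Lemma tensor_contract_pure x : tensor_contract (@f) (pure x) = \prod_i @f i (x i).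
Proof. exact: (tensor_lift_pure contract_multilinear). Qed.

End Contract.

Section Slice.
Variable i : I.
Hypothesis fl : forall k, k != i -> linear (@f k : V k -> K^o).

Let slice_multilinear :
  multilinear (fun x : forall i, V i => (\prod_(k | k != i) @f k (x k)) *: x i).
Proof.
move=> x j a u v; case: (eqVneq j i) => [ji|ji].
  move: u v; rewrite ji => u v; rewrite !dfwith_in.
  have E (w : V i) : \prod_(k | k != i) @f k (dfwith x w k) =
             \prod_(k | k != i) @f k (x k).
    by apply: eq_bigr => k ki; rewrite dfwith_out // eq_sym.
  by rewrite !E scalerDr !scalerA mulrC.
rewrite (prod_multilinear (P := fun k => k != i)) // !(dfwith_out _ _ ji).
by rewrite scalerDl scalerA.
Qed.

Lemma tensor_slice_linear : linear (tensor_slice i (@f)).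
Proof. exact: tensor_lift_linear slice_multilinear. Qed.

Lemma tensor_slice_pure x :
  tensor_slice i (@f) (pure x) = (\prod_(k | k != i) @f k (x k)) *: x i.
Proof. exact: (tensor_lift_pure slice_multilinear). Qed.
End Slice.
End Functionals.
End TensorFunctoriality.

Section PureSpan.
Variables (K : fieldType) (I : finType) (V : I -> lmodType K).

Definition pure_span (N : forall i, set (V i)) : set (tensor V) :=
  lspan [set t | exists2 x : forall i, V i, (forall i, N i (x i)) & t = pure x].

Lemma pure_span_setT t : pure_span (fun=> setT) t.
Proof.
elim/tensor_ind: t => [|a x t IH]; first exact: lspan0.
by apply: lspanZD => //; exists x.
Qed.

Lemma pure_spanP (N : forall i, set (V i)) t : pure_span N t ->
  exists n (c : nat -> K) (x : nat -> forall i, V i),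
    (forall k, (k < n)%N -> forall i, N i (x k i)) /\
    t = \sum_(k < n) c k *: pure (x k).
Proof.
elim=> [|a _ t' [x Nx ->] _ [n [c [y [Ny ->]]]]].
  by exists 0%N, (fun=> 0), (fun=> fun=> 0); rewrite big_ord0.
exists n.+1, (fun k => if k is k'.+1 then c k' else a),
  (fun k => if k is k'.+1 then y k' else x); split=> [[|k]//|]; first exact: Ny.
by rewrite big_ord_recl.
Qed.

(** Applying operators slot by slot to the entries of a fixed expression of a tensor
    is multilinear in the operators; this is how finite-rank identities are
    expanded into rank-one operators. *)
Lemma pure_sum_multilinear n (c : nat -> K) (x : nat -> forall i, V i) :
  @multilinear K I (fun i => (V i -> V i) : lmodType K) (tensor V)
    (fun g => \sum_(k < n) c k *: pure (fun i => g i (x k i))).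
Proof.
apply: multilinear_sum => k; apply: multilinear_linear.
  by move=> a u v; rewrite scalerDr !scalerA mulrC.
apply: (@multilinear_comp K I (fun i => (V i -> V i) : lmodType K) V _
  (fun i (g : V i -> V i) => g (x k i))) => //.
exact: pure_multilinear.
Qed.

Variable L : forall i, set (V i -> K).
Hypothesis L_linear : forall i f, @L i f -> linear (f : V i -> K^o).
Hypothesis L_separating : forall i, separating (@L i).

(** A tensor involves finitely many entries in each slot, so finite-rank
    operators q i fix it; expanding every q i into rank-one operators writes the
    tensor as a combination of pure tensors whose coefficients are its
    contractions by functionals of L. *)
Lemma tensor_separate t :
  (forall f, (forall i, @L i (f i)) -> tensor_contract f t = 0) -> t = 0.
Proof.
move=> t0; have [n [c [x [_ tE]]]] := pure_spanP (pure_span_setT t).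
have /family_choice[q qP] : forall i, exists q : V i -> V i,
    lspan (rank_one (@L i) setT) q /\ forall k, (k < n)%N -> q (x k i) = x k i.
  move=> i.
  have [//|//|//|q qL qx] := @finite_rank_identity K (V i) (@L i) (@L_linear i)
    (@L_separating i) setT [seq x k i | k <- iota 0 n].
  exists q; split=> // k kn; apply: qx; apply: map_f.
  by rewrite mem_iota.
suff: lspan set0 t by elim=> // a u v [].
have -> : t = \sum_(k < n) c k *: pure (fun i => q i (x k i)).
  rewrite tE; apply: eq_bigr => k _; congr (_ *: pure _).
  by apply/functional_extensionality_dep => i; rewrite (qP i).2.
apply: (multilinear_span (pure_sum_multilinear n c x)
  (S := fun i => rank_one (@L i) setT)) => [g gP|i]; last exact: (qP i).1.
have /family_choice[f fP] := gP; have /family_choice[w wP] := fP.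
have fL i : @L i (f i) by have [] := wP i.
have -> : \sum_(k < n) c k *: pure (fun i => g i (x k i)) =
          tensor_contract f t *: pure w.
  rewrite tE (linear_fun_sum (tensor_contract_linear (fun i => L_linear (fL i)))).
  rewrite scaler_suml; apply: eq_bigr => k _.
  rewrite (linear_funZ (tensor_contract_linear (fun i => L_linear (fL i)))).
  rewrite (tensor_contract_pure (fun i => L_linear (fL i))) -scalerA.
  rewrite -(multilinear_scale (@pure_multilinear K I V)); congr (_ *: pure _).
  by apply/functional_extensionality_dep => i; have [_ _ ->] := wP i.
by rewrite t0 // scale0r; apply: lspan0.
Qed.

(** The condition on slices says that, for each i separately, slot i of t can be
    taken in N i, and the point is that this can be done for all i at once.  To
    bring slot i into N i, the other slots are expanded by finite-rank operators,
    which leaves a slice of t in slot i; the operators in the slots already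
    treated take values in N, so these slots remain in N. *)
Lemma pure_span_slices (N : forall i, set (V i)) t :
  (forall i, N i 0) ->
  (forall i a x y, N i x -> N i y -> N i (a *: x + y)) ->
  (forall i f, (forall k, k != i -> @L k (f k)) -> N i (tensor_slice i f t)) ->
  pure_span N t.
Proof.
move=> N0 NP tN.
(* P lists the slots already known to lie in N. *)
pose NQ (P : seq I) i := [set v : V i | i \in P -> N i v].
suff H P : pure_span (NQ P) t.
  apply: lspan_sub (H (enum I)) => _ [x Nx ->]; exists x => // i.
  by apply: Nx; rewrite mem_enum.
elim: P => [|i P IH].
  by apply: lspan_sub (pure_span_setT t) => _ [x _ ->]; exists x => // i.
have [n [c [x [xN tE]]]] := pure_spanP IH.
have NQ0 P' j : NQ P' j 0 by move=> _; apply: N0.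
have NQP P' j a u v : NQ P' j u -> NQ P' j v -> NQ P' j (a *: u + v).
  by move=> Nu Nv jP; apply: NP; [apply: Nu | apply: Nv].
have /family_choice[q qP] : forall j, exists q : V j -> V j,
    lspan [set g | if j == i then g = id else rank_one (@L j) (NQ P j) g] q
    /\ forall k, (k < n)%N -> q (x k j) = x k j.
  move=> j; case: (eqVneq j i) => [_|ji].
    by exists id; split=> //; apply: lspan_mem.
  have [|v|q qL qx] := @finite_rank_identity K (V j) (@L j) (@L_linear j)
    (@L_separating j) (NQ P j) [seq x k j | k <- iota 0 n] (NQ0 P j).
  - exact: NQP.
  - by move=> /mapP[k kn ->]; apply: xN; rewrite mem_iota in kn.
  exists q; split=> // k kn; apply: qx; apply: map_f.
  by rewrite mem_iota.
have -> : t = \sum_(k < n) c k *: pure (fun i => q i (x k i)).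
  rewrite tE; apply: eq_bigr => k _; congr (_ *: pure _).
  by apply/functional_extensionality_dep => j; rewrite (qP j).2.
apply: (multilinear_span (pure_sum_multilinear n c x)
  (S := fun j => [set g | if j == i then g = id else rank_one (@L j) (NQ P j) g]))
  => [g gP|j]; last exact: (qP j).1.
(* In slot i the functional and the vector are dummies. *)
have /family_choice[f fP] : forall j, exists f, j != i -> exists w,
    [/\ @L j f, NQ P j w & g j = fun v => f v *: w].
  move=> j; have := gP j => /=; case: (eqVneq j i) => [_ _|ji]; first by exists (fun=> 0).
  by move=> [f fP]; exists f.
have /family_choice[w wP] : forall j, exists w, j != i ->
    [/\ @L j (f j), NQ P j w & g j = fun v => f j v *: w].
  move=> j; case: (eqVneq j i) => [_|/fP[w wP]]; first by exists 0.
  by exists w.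
have fL j : j != i -> @L j (f j) by move=> /wP[].
have fl j ji := L_linear (fL j ji).
set y := tensor_slice i f t.
have -> : \sum_(k < n) c k *: pure (fun i => g i (x k i)) = pure (dfwith w y).
  have pl : linear (fun z : V i => pure (dfwith w z)).
    by move=> a u v; apply: pure_multilinear.
  rewrite /y tE (linear_fun_sum (tensor_slice_linear fl)) (linear_fun_sum pl).
  apply: eq_bigr => k _.
  rewrite (linear_funZ (tensor_slice_linear fl)) (linear_funZ pl).
  rewrite (tensor_slice_pure fl) (linear_funZ pl); congr (_ *: _).
  rewrite -[X in X *: _]mul1r.
  have -> : 1 * \prod_(j | j != i) f j (x k j) =
            \prod_j (if j == i then 1 else f j (x k j)).
    rewrite [RHS](bigD1 i) //= eqxx; congr (_ * _).
    by apply: eq_bigr => j /negPf->.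
  rewrite -(multilinear_scale (@pure_multilinear K I V)); congr pure.
  apply/functional_extensionality_dep => j; case: dfwithP => [|l il].
    by rewrite eqxx scale1r; have := gP i; rewrite /= eqxx => ->.
  rewrite eq_sym (negPf il); have [|_ _ ->//] := wP l.
  by rewrite eq_sym.
apply: lspan_mem; exists (dfwith w y) => // j.
case: dfwithP => [_|l il lP]; first exact: tN.
rewrite inE eq_sym (negPf il) /= in lP.
by have [|_ + _] := wP l; [rewrite eq_sym | apply].
Qed.
End PureSpan.

(** * Friendly families in terms of shifted diagonals *)

Section Friendly.
Variables (K : fieldType) (I : finType) (R : I -> stdGradedAlg K).

Local Notation tR := (tensor_alg (fun i => R i)).
Local Notation degR := (fun i => int_degree (@adeg K (R i))).

(** The Segre product of the R i (d i), inside the tensor product of the R i.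
    As R i (d i) is the dual of R i (- d i), this is where the value at
    x_1 (x) ... (x) x_m of a map defined on Segre products belongs when x_i has
    degree d i. *)
Definition diag_set (d : I -> int) : set tR :=
  @segre_set K I (fun i => R i) int (fun i j => degR i (d i + j)).

Lemma int_degree_mul i (e k : int) (a b : R i) :
  degR i e a -> degR i k b -> degR i (e + k) (a * b).
Proof.
case: e => [n|n] Da Db; first exact: int_adegM.
rewrite Da mul0r; exact: (grading0 (int_adeg_grading (R i))).
Qed.

Section Shifts.
Variable d : I -> int.
Local Notation Rd := (fun i => shift (regular_fgmod (R i)) (- d i)).
Local Notation fM := (fun i => restrict_scalars (Rd i) : lmodType K).
Local Notation fD := (fun i => restrict_scalars (dual_gmod (Rd i)) : lmodType K).

Definition dual_id i : dual (Rd i) := (idfun : {linear (R i)^o -> (R i)^o}).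

(** With [dual_eval1], this identifies R (d) with the dual of R (- d).  It is kept
    as a map between distinct vector spaces because restricting scalars along
    K -> R gives R a K-action that is not convertible to its own. *)
Definition dual_mul i (a : R i) : restrict_scalars (dual_gmod (Rd i)) :=
  (a *: dual_id i : dual (Rd i)).

Definition dual_eval1 i (f : restrict_scalars (dual_gmod (Rd i))) : R i :=
  (f : dual (Rd i)) (1 : R i).

Lemma dual_mulE i (a x : R i) : (dual_mul a : dual (Rd i)) x = a * x.
Proof. by []. Qed.

Lemma dual_mul_linear i : linear (@dual_mul i).
Proof.
move=> c a b; apply: (@dualP (R i) (Rd i)) => x.
rewrite dual_mulE mulrDl -mulr_algl -mulrA; exact: erefl.
Qed.

Lemma dual_eval1_linear i : linear (@dual_eval1 i).
Proof. by move=> c f g; rewrite -[in RHS]mulr_algl. Qed.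

Lemma dual_mulK i : cancel (@dual_mul i) (@dual_eval1 i).
Proof. by move=> a; rewrite /dual_eval1 dual_mulE mulr1. Qed.

Let mulr := tensor_map2_linearr (mul_bilinear (fun i => R i)).

Lemma tensor_eval1 (t : tensor fD) (r : forall i, R i) :
  @tensor_eval K I R Rd t (@pure K I fM r) =
  (pure r : tR) * tensor_map dual_eval1 t.
Proof.
have evl := tensor_map2_linearl (eval_bilinear Rd).
move: t; apply: (@tensor_ext K I fD (tensor (fun i => R i))).
- by move=> a t u; apply: evl.
- by move=> a t u; rewrite (tensor_map_linear dual_eval1_linear); apply: mulr.
move=> f; rewrite (tensor_eval_pure f r) (tensor_map_pure dual_eval1_linear).
rewrite [RHS](tensor_mul_pure r); congr pure.
apply/functional_extensionality_dep => i.
rewrite -[r i in LHS]mulr1; exact: (linearZZ (f i : dual (Rd i)) (r i) (1 : R i)).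
Qed.

Lemma tensor_mul_eval1 (t : tensor (fun i => R i)) :
  tensor_map dual_eval1 (tensor_map dual_mul t) = t.
Proof.
move: t; apply: tensor_ext => [a t u|//|x].
  by rewrite (tensor_map_linear dual_mul_linear) (tensor_map_linear dual_eval1_linear).
rewrite (tensor_map_pure dual_mul_linear) (tensor_map_pure dual_eval1_linear).
by congr pure; apply/functional_extensionality_dep => i; apply: dual_mulK.
Qed.

Lemma dual_mul_deg i j (a : R i) : degR i (d i + j) a ->
  @mdeg K (R i) (dual_gmod (Rd i)) j (dual_mul a).
Proof.
move=> Da; suff: dual_deg (degR i) (@mdeg K (R i) (Rd i)) j (dual_mul a) by [].
move=> k x Dx; rewrite dual_mulE mulrC.
have -> : k + j = (- d i + k) + (d i + j) by rewrite addrACA addNr add0r.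
exact: int_degree_mul.
Qed.

Lemma dual_eval1_deg i j (f : dual (Rd i)) :
  @mdeg K (R i) (dual_gmod (Rd i)) j f -> degR i (d i + j) (dual_eval1 f).
Proof.
move=> Df; suff: degR i (- d i + d i) (1 : R i) by move/(Df (d i)).
by rewrite addNr; apply/adeg0P; exists 1; rewrite scale1r.
Qed.

Hypothesis Rfriendly : natural_map_iso Rd.

(** The form in which injectivity of alpha is used: an element of diag_set d is
    zero as soon as the Segre product of the R i (- d i) annihilates it. *)
Lemma friendly_inj (u : tR) : diag_set d u ->
  (forall k (r : forall i, R i), (forall i, degR i (k - d i) (r i)) ->
    (pure r : tR) * u = 0) -> u = 0.
Proof.
move=> Du u0.
have Dt : @segre_set K I fD int (fun i => @mdeg K (R i) (dual_gmod (Rd i)))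
    (tensor_map dual_mul u).
  move: u Du {u0}; apply: (lspan_linear (tensor_map_linear dual_mul_linear)).
  move=> _ [j [x Dx ->]]; rewrite (tensor_map_pure dual_mul_linear).
  apply: lspan_mem; exists j; exists (fun i => dual_mul (x i)) => // i.
  exact: dual_mul_deg.
have tS : tensor_map dual_mul u \in @segre_mod_pred K I R (fun i => dual_gmod (Rd i)).
  exact/asboolP.
have [[g gK _] _] := Rfriendly.
have t0 : SegreMod tS = 0 :> segre_dual Rd.
  apply: (can_inj gK); rewrite linear0; apply: dualP => x; apply: val_inj.
  suff ev0 y : @segre_set K I fM int (fun i => @mdeg K (R i) (Rd i)) y ->
      @tensor_eval K I R Rd (tensor_map dual_mul u) y = 0.
    by apply: ev0; apply/asboolP/(valP x).
  have evr : linear (@tensor_eval K I R Rd (tensor_map dual_mul u)).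
    exact: (tensor_map2_linearr (eval_bilinear Rd)).
  elim=> [|a _ y' [k [r Dr ->]] _ IH]; first exact: (linear_fun0 evr).
  rewrite evr IH addr0 tensor_eval1 tensor_mul_eval1 (u0 k) ?scaler0 // => i.
  by rewrite addrC; apply: Dr.
rewrite -[u]tensor_mul_eval1.
have /= -> : tensor_map dual_mul u = 0 by have := congr1 val t0.
exact: (linear_fun0 (tensor_map_linear dual_eval1_linear)).
Qed.

(** The form in which surjectivity of alpha is used: every T-linear map from the
    Segre product of the R i (- d i) to T is a multiplication. *)
Lemma friendly_surj (f : dual_segre Rd) : exists2 u : tR, diag_set d u &
  forall x (r : forall i, R i), val x = @pure K I fM r ->
    val (f x) = (pure r : tR) * u.
Proof.
have [[g _ gK] _] := Rfriendly.
exists (tensor_map dual_eval1 (val (g f))).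
  have /asboolP := valP (g f); move: (val _) => t.
  apply: (lspan_linear (tensor_map_linear dual_eval1_linear)).
  move=> _ [j [h Dh ->]]; rewrite (tensor_map_pure dual_eval1_linear).
  apply: lspan_mem; exists j; exists (fun i => dual_eval1 (h i)) => // i.
  exact: dual_eval1_deg.
by move=> x r xr; rewrite -[in LHS](gK f) alphaE xr tensor_eval1.
Qed.
End Shifts.
End Friendly.

(** * Injectivity of the natural map *)

Section Injectivity.
Variables (K : fieldType) (I : finType) (R : I -> stdGradedAlg K).
Variable M : forall i, fgGradedMod (R i).

Local Notation tR := (tensor_alg (fun i => R i)).
Local Notation degR := (fun i => int_degree (@adeg K (R i))).
Local Notation degM := (fun i => @mdeg K (R i) (M i)).
Local Notation degD := (fun i => @mdeg K (R i) (dual_gmod (M i))).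
Local Notation fM := (fun i => restrict_scalars (M i) : lmodType K).
Local Notation fD := (fun i => restrict_scalars (dual_gmod (M i)) : lmodType K).

Lemma mdegZ_int i (e k : int) (a : R i) (x : M i) :
  degR i e a -> degM i k x -> degM i (e + k) (a *: x).
Proof.
case: e => [n|n] /= Da Dx; first exact: mdegZ.
by rewrite Da scale0r; apply: (grading0 (@mdeg_grading K (R i) (M i))).
Qed.

Lemma segre_modP (k : int) (x : forall i, M i) : (forall i, degM i k (x i)) ->
  exists y : segre_mod (fun i => M i), val y = @pure K I fM x.
Proof.
move=> Dx.
have yS : @pure K I fM x \in @segre_mod_pred K I R (fun i => M i).
  by apply/asboolP/lspan_mem; exists k, x.
by exists (SegreMod yS).
Qed.

Definition dual_at (x : forall i, M i) i (f : restrict_scalars (dual_gmod (M i))) : R i :=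
  (f : dual (M i)) (x i).

Lemma dual_at_linear x i : linear (@dual_at x i).
Proof. by move=> a f g; rewrite -[in RHS]mulr_algl. Qed.

Lemma tensor_eval_at (t : tensor fD) x :
  @tensor_eval K I R M t (@pure K I fM x) = tensor_map (dual_at x) t.
Proof.
have evl := tensor_map2_linearl (eval_bilinear M).
move: t; apply: tensor_ext => [|| f].
- exact: evl.
- exact: tensor_map_linear (dual_at_linear x).
by rewrite tensor_eval_pure (tensor_map_pure (dual_at_linear x)).
Qed.

Lemma tensor_eval_diag (t : tensor fD) (d : I -> int) (x : forall i, M i) :
  @segre_set K I fD int degD t -> (forall i, degM i (d i) (x i)) ->
  diag_set d (tensor_map (dual_at x) t).
Proof.
move=> Dt Dx; move: t Dt; apply: (lspan_linear (tensor_map_linear (dual_at_linear x))).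
move=> _ [j [f Df ->]]; rewrite (tensor_map_pure (dual_at_linear x)).
apply: lspan_mem; exists j; exists (fun i => dual_at x (f i)) => // i.
exact: (Df i _ _ (Dx i)).
Qed.

Lemma dual_separate i (f : dual (M i)) :
  (forall k x, degM i k x -> f x = 0) -> f = 0.
Proof.
move=> f0; apply: dualP => x; rewrite dual0E.
elim/(grading_ind (@mdeg_grading K (R i) (M i))): x => [|x y fx fy|]; last exact: f0.
  exact: linear0.
by rewrite linearD fx fy addr0.
Qed.

(** Composing a functional of R i with evaluation at a homogeneous element gives
    a separating family of functionals on the dual of M i. *)
Lemma tensor_dual_eq0 (t : tensor fD) :
  (forall (d : I -> int) (x : forall i, M i), (forall i, degM i (d i) (x i)) ->
    tensor_map (dual_at x) t = 0) -> t = 0.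
Proof.
move=> t0; pose L i : set (fD i -> K) := [set f | exists m : R i -> K,
  linear (m : R i -> K^o) /\ exists k x, degM i k x /\
  f = fun g => m ((g : dual (M i)) x)].
apply: (@tensor_separate K I fD L) => [i _ [m [ml [k [x [_ ->]]]]]|i f f0|f fL].
- by move=> a g h; rewrite -[RHS]ml; congr m; rewrite -[in RHS]mulr_algl.
- have /existsNP[k /existsNP[x /not_implyP[Dx /eqP fx]]] :
      ~ forall k x, degM i k x -> (f : dual (M i)) x = 0.
    by move=> /dual_separate fE; rewrite fE eqxx in f0.
  have [m [ml mfx]] := functionals_separate fx.
  by exists (fun g => m ((g : dual (M i)) x)) => //; exists m; split=> //; exists k, x.
have /family_choice[m mP] := fL.
have ml i : linear (m i : R i -> K^o) by case: (mP i).
have /family_choice[d dP] : forall i, exists k, exists x, degM i k x /\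
  f i = fun g => m i ((g : dual (M i)) x) by move=> i; case: (mP i).
have /family_choice[x xP] := dP.
have -> : tensor_contract f t = tensor_contract m (tensor_map (dual_at x) t).
  move: t {t0}; apply: (@tensor_ext K I fD K^o).
  - apply: tensor_contract_linear => i; rewrite (xP i).2 => a g h.
    by rewrite -[RHS]ml; congr (m i _); rewrite -[in RHS]mulr_algl.
  - move=> a u v; rewrite (tensor_map_linear (dual_at_linear x)).
    exact: (tensor_contract_linear ml).
  move=> g; rewrite (tensor_map_pure (dual_at_linear x)) (tensor_contract_pure ml).
  rewrite tensor_contract_pure => [|i]; last first.
    rewrite (xP i).2 => a u v.
    by rewrite -[RHS]ml; congr (m i _); rewrite -[in RHS]mulr_algl.
  by apply: eq_bigr => i _; rewrite (xP i).2.
by rewrite (t0 d) ?(linear_fun0 (tensor_contract_linear ml)) // => i; case: (xP i).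
Qed.

Hypothesis Rfriendly : friendly R.

(** The tensor x_1 (x) ... (x) x_m does not lie in the Segre product when the
    degrees differ, so alpha t says nothing directly about the value u of t
    there.  But r_1 x_1 (x) ... (x) r_m x_m lies in it for suitable r, so alpha t
    determines the products r u, hence u by [friendly_inj]. *)
Lemma alpha_injective : injective (alpha M).
Proof.
move=> t u tu; apply/eqP; rewrite -subr_eq0; apply/eqP.
have : alpha M (t - u) = 0 by rewrite linearB /= tu subrr.
move: (t - u) => {tu}{}t {u} t0; apply: val_inj.
apply: tensor_dual_eq0 => d x Dx.
have /asboolP tS := valP t.
apply: (friendly_inj (Rfriendly (fun i => - d i)) (tensor_eval_diag tS Dx)).
move=> k r Dr.
have [|y yE] := @segre_modP k (fun i => r i *: x i).
  by move=> i; rewrite -(subrK (d i) k); apply: mdegZ_int.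
have e0 : val (alpha M t y) = 0 := congr1 (fun g : dual_segre M => val (g y)) t0.
rewrite alphaE yE in e0; rewrite -e0 -tensor_eval_at.
rewrite -[LHS]tensor_eval_act; congr tensor_eval.
by rewrite /tensor_act (tensor_map2_pure (act_bilinear (fun i => M i))).
Qed.
End Injectivity.

(** * Values of a Segre functional at homogeneous tuples *)

Section Lifting.
Variables (K : fieldType) (I : finType) (R : I -> stdGradedAlg K).
Hypothesis Rfriendly : friendly R.
Variable M : forall i, fgGradedMod (R i).

Local Notation tR := (tensor_alg (fun i => R i)).
Local Notation degR := (fun i => int_degree (@adeg K (R i))).
Local Notation degM := (fun i => @mdeg K (R i) (M i)).
Local Notation fM := (fun i => restrict_scalars (M i) : lmodType K).

Variable f : dual_segre M.

(** u is the value that f ought to take at x_1 (x) ... (x) x_m, for x_i of degree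
    d i: whenever r_1 x_1 (x) ... (x) r_m x_m lies in the Segre product, f maps it
    to r u. *)
Definition is_lift (d : I -> int) (x : forall i, M i) (u : tR) : Prop :=
  diag_set d u /\
  forall k (r : forall i, R i), (forall i, degR i (k - d i) (r i)) ->
  forall y : segre_mod (fun i => M i), val y = @pure K I fM (fun i => r i *: x i) ->
    val (f y) = (pure r : tR) * u.

Section Existence.
Variables (d : I -> int) (x : forall i, M i).
Hypothesis Dx : forall i, degM i (d i) (x i).
Local Notation Rd := (fun i => shift (regular_fgmod (R i)) (- d i)).
Local Notation fR := (fun i => restrict_scalars (Rd i) : lmodType K).

Definition scale_at i (a : restrict_scalars (Rd i)) : restrict_scalars (M i) :=
  (a : R i) *: (x i : M i).

Lemma scale_at_linear i : linear (@scale_at i).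
Proof.
move=> c a b; 
rewrite -[RHS]/((c%:A : R i) *: ((a : R i) *: (x i : M i)) + (b : R i) *: (x i : M i)).
rewrite scalerA -scalerDl.
exact: erefl.
Qed.

Lemma scale_at_segre (r : segre_mod Rd) :
  tensor_map scale_at (val r) \in @segre_mod_pred K I R (fun i => M i).
Proof.
apply/asboolP; have /asboolP := valP r; move: (val r).
apply: (lspan_linear (tensor_map_linear scale_at_linear)) => _ [j [a Da ->]].
rewrite (tensor_map_pure scale_at_linear); apply: lspan_mem.
exists j; exists (fun i => scale_at (a i)) => // i.
rewrite -(subrK (d i) j) [j - _]addrC; apply: mdegZ_int => //.
exact: (Da i).
Qed.

(** f precomposed with multiplication of x_1 (x) ... (x) x_m by the Segre product
    of the R i (- d i); a friendly family makes it a multiplication. *)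
Definition along (r : segre_mod Rd) : segre_alg R := f (SegreMod (scale_at_segre r)).

Lemma along_linear : linear (along : _ -> (segre_alg R)^o).
Proof.
have actl := tensor_map2_linearl (act_bilinear (fun i => M i)).
have actr := tensor_map2_linearr (act_bilinear (fun i => M i)).
have actRl := tensor_map2_linearl (act_bilinear Rd).
have actRr := tensor_map2_linearr (act_bilinear Rd).
have sl := tensor_map_linear scale_at_linear.
have act (a : tR) (r : tensor fR) : tensor_map scale_at (@tensor_act K I R Rd a r) =
    @tensor_act K I R (fun i => M i) a (tensor_map scale_at r).
  move: a r; apply: (@tensor_ext2 K I (fun i => R i) fR (tensor fM)).
  - by move=> r b s t; rewrite /tensor_act actRl sl.
  - by move=> r; apply: actl.
  - by move=> a b s t; rewrite /tensor_act actRr sl.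
  - by move=> a b s t; rewrite sl /tensor_act actr.
  move=> a r; rewrite (tensor_map_pure scale_at_linear) /tensor_act.
  rewrite (tensor_map2_pure (act_bilinear (fun i => M i))).
  rewrite (tensor_map2_pure (act_bilinear Rd)) (tensor_map_pure scale_at_linear).
  congr pure; apply/functional_extensionality_dep => i.
  by rewrite /scale_at [RHS]scalerA.
move=> a r r'; rewrite -[RHS](linearP f) /along; congr (f _); apply: val_inj.
by rewrite /= -act (linear_funD sl).
Qed.

Definition along_dual : dual_segre Rd :=
  HB.pack (along : _ -> (segre_alg R)^o)
    (GRing.isLinear.Build (segre_alg R) (segre_mod Rd) (segre_alg R)^o *:%R
       (along : _ -> (segre_alg R)^o) along_linear).

Lemma lift_exists : exists u, is_lift d x u.
Proof.
have [u Du uE] := friendly_surj (Rfriendly (fun i => - d i)) along_dual.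
exists u; split=> // k r Dr y yE.
have rS : @pure K I fR r \in @segre_mod_pred K I R Rd.
  apply/asboolP/lspan_mem; exists k; exists r => // i.
  by rewrite /mdeg /= addrC; apply: Dr.
rewrite -(uE (SegreMod rS) r erefl); congr (val (f _)); apply: val_inj.
by rewrite yE /= (tensor_map_pure scale_at_linear).
Qed.

Lemma lift_unique u v : is_lift d x u -> is_lift d x v -> u = v.
Proof.
move=> [Du uE] [Dv vE]; apply/eqP; rewrite -subr_eq0; apply/eqP.
apply: (friendly_inj (Rfriendly (fun i => - d i))).
  by rewrite /diag_set /segre_set -scaleN1r; apply: lspanD => //; apply: lspanZ.
move=> k r Dr; rewrite mulrBr.
have [|y yE] := @segre_modP K I R M k (fun i => r i *: x i).
  by move=> i; rewrite -(subrK (d i) k); apply: mdegZ_int.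
by rewrite -(uE k r Dr y yE) -(vE k r Dr y yE) subrr.
Qed.
End Existence.

(** The image of R i in the tensor product of all the R k; multilinearity over the
    rings R i is expressed through it. *)
Definition slot_scalar i (a : R i) : tR := pure (dfwith (fun k => 1 : R k) a).

Lemma lift_scale d x u i e (a : R i) : is_lift d x u -> degR i e a ->
  is_lift (dfwith (i := i) d (e + d i)) (dfwith x (a *: x i)) (slot_scalar a * u).
Proof.
have mulr := tensor_map2_linearr (mul_bilinear (fun i => R i)).
move=> [Du uE] Da; split.
  move: u Du {uE}; apply: (lspan_linear (mulr _)) => _ [j [z Dz ->]].
  rewrite (tensor_map2_pure (mul_bilinear (fun i => R i))); apply: lspan_mem; exists j.
  exists (fun k => dfwith (fun k => 1 : R k) a k * z k : R k) => // k.
  case: dfwithP => [|l il]; rewrite ?dfwith_in.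
    by rewrite -addrA; apply: int_degree_mul.
  by rewrite (dfwith_out _ _ il) mul1r.
move=> k r Dr y yE.
have E : (pure r : tR) * slot_scalar a =
    pure (fun j => r j * dfwith (fun k => 1 : R k) a j : R j).
  exact: tensor_mul_pure.
rewrite mulrA E; apply: (uE k) => [j|].
  have := Dr j; case: dfwithP => [|l il]; last by rewrite dfwith_out // mulr1.
  rewrite dfwith_in => Dri; rewrite (_ : k - d i = (k - (e + d i)) + e).
    exact: int_degree_mul.
  by rewrite opprD [- e - _]addrC addrA subrK.
rewrite yE; congr pure; apply/functional_extensionality_dep => j.
case: dfwithP => [|l il]; first by rewrite dfwith_in scalerA.
by rewrite dfwith_out // mulr1.
Qed.

Lemma lift_add d x u v i e (p q : M i) :
  (forall j, j != i -> degM j (d j) (x j)) -> degM i e p -> degM i e q ->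
  is_lift (dfwith (i := i) d e) (dfwith x p) u ->
  is_lift (dfwith (i := i) d e) (dfwith x q) v ->
  is_lift (dfwith (i := i) d e) (dfwith x (p + q)) (u + v).
Proof.
move=> Dx Dp Dq [Du uE] [Dv vE]; split; first exact: lspanD.
move=> k r Dr y yE.
have hom w : degM i e w -> forall j, degM j k (r j *: (dfwith x w j : M j)).
  move=> Dw j; rewrite -(subrK (dfwith (i := i) d e j) k); apply: mdegZ_int => //.
  case: dfwithP => [|l il]; first by rewrite dfwith_in.
  by rewrite dfwith_out //; apply: Dx; rewrite eq_sym.
have [y1 y1E] := segre_modP (hom p Dp); have [y2 y2E] := segre_modP (hom q Dq).
rewrite mulrDr -(uE k r Dr y1 y1E) -(vE k r Dr y2 y2E).
have -> : y = y1 + y2.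
  apply: val_inj; rewrite /= y1E y2E yE.
  have E w : (fun j => r j *: (dfwith x w j : M j)) =
      dfwith (fun j => r j *: x j) (r i *: w).
    apply/functional_extensionality_dep => j.
    by case: dfwithP => [|l il]; rewrite ?dfwith_in ?dfwith_out.
  have := @pure_multilinear K I fM (fun j => r j *: x j) i 1 (r i *: p) (r i *: q).
  by rewrite !scale1r !E scalerDr.
by rewrite linearD.
Qed.

(** The degree is recorded because the zero vector has every degree. *)
Definition homogeneous i : Type := {p : int * M i | degM i p.1 p.2}.
Definition hdeg i (h : homogeneous i) : int := (sval h).1.
Definition helt i (h : homogeneous i) : M i := (sval h).2.

Lemma hdegP i (h : homogeneous i) : degM i (hdeg h) (helt h).
Proof. exact: svalP h. Qed.

Definition mk_homogeneous i k (x : M i) (Dx : degM i k x) : homogeneous i :=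
  exist (fun p : int * M i => degM i p.1 p.2) (k, x) Dx.

Lemma graded_lift : exists s : (forall i, homogeneous i) -> tR,
  forall h, is_lift (fun i => hdeg (h i)) (fun i => helt (h i)) (s h).
Proof.
suff /family_choice[s sP] : forall h : (forall i, homogeneous i),
    exists u, is_lift (fun i => hdeg (h i)) (fun i => helt (h i)) u by exists s.
by move=> h; apply: lift_exists => i; apply: hdegP.
Qed.

Section GradedLift.
Variable s : (forall i, homogeneous i) -> tR.
Hypothesis sP : forall h, is_lift (fun i => hdeg (h i)) (fun i => helt (h i)) (s h).

Lemma lift_eq h u : is_lift (fun i => hdeg (h i)) (fun i => helt (h i)) u -> u = s h.
Proof. by move=> uP; apply: lift_unique uP (sP h) => i; apply: hdegP. Qed.

Lemma slot_lift (h : forall i, homogeneous i) i (g : homogeneous i) :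
  is_lift (dfwith (i := i) (fun i => hdeg (h i)) (hdeg g))
    (dfwith (fun i => helt (h i)) (helt g))
    (s (dfwith h g)).
Proof. by have := sP (dfwith h g); rewrite !dfwith_map. Qed.

Lemma slot_lift_eq (h : forall i, homogeneous i) i (g : homogeneous i) u :
  is_lift (dfwith (i := i) (fun i => hdeg (h i)) (hdeg g))
    (dfwith (fun i => helt (h i)) (helt g)) u ->
  u = s (dfwith h g).
Proof. by move=> uP; apply: lift_eq; rewrite !dfwith_map. Qed.

(** This and the next lemma say that the lift s is multilinear over the rings R i:
    both sides are lifts of f at the same elements, and lifts are unique. *)
Lemma lift_slot_add h i (g1 g2 g : homogeneous i) :
  hdeg g1 = hdeg g -> hdeg g2 = hdeg g -> helt g = helt g1 + helt g2 ->
  s (dfwith h g) = s (dfwith h g1) + s (dfwith h g2).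
Proof.
move=> e1 e2 gE; apply/esym/slot_lift_eq; rewrite gE.
apply: lift_add => [j _||||].
- exact: hdegP.
- by rewrite -e1; apply: hdegP.
- by rewrite -e2; apply: hdegP.
- by rewrite -e1; apply: slot_lift.
- by rewrite -e2; apply: slot_lift.
Qed.

Lemma lift_slot_scale h i e (a : R i) (g g' : homogeneous i) :
  degR i e a -> hdeg g' = e + hdeg g -> helt g' = a *: helt g ->
  s (dfwith h g') = slot_scalar a * s (dfwith h g).
Proof.
move=> Da gd gE; apply/esym/slot_lift_eq; rewrite gd gE.
have := lift_scale (slot_lift h g) Da; rewrite !dfwith_in.
have dfwith2 (T : I -> Type) (x : forall i, T i) (v w : T i) :
    dfwith (dfwith x v) w = dfwith x w.
  apply/functional_extensionality_dep => j.
  by case: dfwithP => [|l il]; rewrite ?dfwith_in ?dfwith_out.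
by rewrite !dfwith2.
Qed.

Lemma lift_slot_comb h i n (g : homogeneous i) (gs : nat -> homogeneous i)
    (a : nat -> R i) :
  (forall l, degR i (hdeg g - hdeg (gs l)) (a l)) ->
  helt g = \sum_(l < n) a l *: helt (gs l) ->
  s (dfwith h g) = \sum_(l < n) slot_scalar (a l) * s (dfwith h (gs l)).
Proof.
move=> Da; elim: n g Da => [|n IH] g Da.
  rewrite !big_ord0 => g0; apply: (addIr (s (dfwith h g))); rewrite add0r.
  by rewrite -(lift_slot_add h (erefl (hdeg g))) // g0 addr0.
rewrite !big_ord_recr /= => gE.
have D1 : degM i (hdeg g) (a n *: helt (gs n)).
  by rewrite -(subrK (hdeg (gs n)) (hdeg g)); apply: mdegZ_int (hdegP _).
have D2 : degM i (hdeg g) (\sum_(l < n) a l *: helt (gs l)).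
  have -> : \sum_(l < n) a l *: helt (gs l) = helt g - a n *: helt (gs n).
    by rewrite gE addrK.
  exact: (gradingB (@mdeg_grading K (R i) (M i)) (hdegP g) D1).
rewrite (@lift_slot_add h i (mk_homogeneous D2) (mk_homogeneous D1) g) //.
congr (_ + _); first exact: IH.
by apply: lift_slot_scale (Da n) _ _; rewrite //= subrK.
Qed.
End GradedLift.
End Lifting.

(** * Homogeneous generators and homogeneous functionals *)

Section Generators.
Variables (K : fieldType) (R : stdGradedAlg K) (M : fgGradedMod R).
Local Notation degR := (int_degree (@adeg K R)).
Local Notation degM := (@mdeg K R M).

Lemma hcomp_scale (a : R) (k e : int) (x : M) : degM k x ->
  hcomp degM (a *: x) e = hcomp degR a (e - k) *: x.
Proof.
move=> Dx; have gR := int_adeg_grading R; have gM := @mdeg_grading K R M.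
elim/(grading_ind gR): a => [|a b IHa IHb|j a Da].
- by rewrite scale0r (hcomp0 gM) (hcomp0 gR) scale0r.
- by rewrite scalerDl (hcompD gM) (hcompD gR) IHa IHb scalerDl.
have Dax : degM (j + k) (a *: x).
  case: j Da => [n|n] Da; first exact: mdegZ.
  by rewrite Da scale0r; apply: (grading0 gM).
rewrite (hcomp_hom gM _ Dax) (hcomp_hom gR _ Da) subr_eq.
by case: ifP => _; rewrite ?scale0r.
Qed.

Lemma homogeneous_generators : exists ps : seq (int * M),
  (forall p, p \in ps -> degM p.1 p.2) /\
  forall x, exists r : nat -> R, x = \sum_(l < size ps) r l *: (nth 0 ps l).2.
Proof.
have gM := @mdeg_grading K R M.
have [s sM] := @fgmod_fg K R M.
have /family_choice[t tP] : forall x : M, exists t : seq int,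
    uniq t /\ forall k, k \notin t -> hcomp degM x k = 0.
  by move=> x; have [t ut xt] := hcomp_finite gM x; exists t.
pose ps := [seq (k, hcomp degM x k) | x <- s, k <- t x].
exists ps; split; first by move=> _ /allpairsPdep[x [k [_ _ ->]]]; apply: hcomp_deg.
have lc x : lspan [set` map snd ps] x ->
    exists r : nat -> R, x = \sum_(l < size ps) r l *: (nth 0 ps l).2.
  elim=> [|a _ y /= /mapP[p pps ->] _ [r ->]].
    by exists (fun=> 0); rewrite big1 // => l _; rewrite scale0r.
  exists (fun l => (if l == index p ps then a else 0) + r l).
  under [RHS]eq_bigr => l _ do rewrite scalerDl.
  rewrite big_split /=; congr (_ + _).
  have lt : (index p ps < size ps)%N by rewrite index_mem.
  rewrite (bigD1 (Ordinal lt)) //= eqxx nth_index // big1 ?addr0 // => l ne.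
  by rewrite -val_eqE /= in ne; rewrite (negPf ne) scale0r.
move=> x; apply: lc; elim: (sM x) => [|a u v us _ IH]; first exact: lspan0.
apply: lspanP => //; have [ut uE] := tP u.
rewrite (hcomp_sum gM ut uE) big_seq; apply: lspan_sum => k kt.
apply: lspan_mem => /=; apply/mapP; exists (k, hcomp degM u k) => //.
by apply/allpairsPdep; exists u, k.
Qed.
End Generators.

Section HomogeneousFunctionals.
Variables (K : fieldType) (I : finType) (R : I -> stdGradedAlg K).
Variables (M : forall i, fgGradedMod (R i)) (i : I).
Local Notation degR := (int_degree (@adeg K (R i))).
Local Notation degM := (@mdeg K (R i) (M i)).

(** An R-linear map is the same as an R-linear assignment on homogeneous
    elements: p extends by x |-> \sum_k p (x_k). *)
Lemma homogeneous_functional (p : homogeneous M i -> R i) :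
  (forall g1 g2 g, hdeg g1 = hdeg g -> hdeg g2 = hdeg g ->
    helt g = helt g1 + helt g2 -> p g = p g1 + p g2) ->
  (forall e a g g', degR e a -> hdeg g' = e + hdeg g -> helt g' = a *: helt g ->
    p g' = a * p g) ->
  exists f : dual (M i), forall g, p g = f (helt g).
Proof.
move=> pD pZ; have gM := @mdeg_grading K (R i) (M i).
pose q k x : R i := p (mk_homogeneous (hcomp_deg gM x k)).
have q0 k x : hcomp degM x k = 0 -> q k x = 0.
  move=> x0; apply: (addIr (q k x)); rewrite add0r.
  by apply/esym/pD; rewrite // /helt /= x0 addr0.
have qD k x y : q k (x + y) = q k x + q k y by apply: pD; rewrite // /helt /= hcompD.
pose h (x : M i) : R i := \sum_(k \in [set: int]) q k x.
have hE x (s : seq int) : uniq s -> (forall k, k \notin s -> hcomp degM x k = 0) ->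
    h x = \sum_(k <- s) q k x.
  by move=> us xs; rewrite /h (fsum_seq us) // => k /xs/q0.
have hD x y : h (x + y) = h x + h y.
  have [s us xs] := hcomp_finite gM x; have [t ut yt] := hcomp_finite gM y.
  have st k : k \notin undup (s ++ t) -> hcomp degM x k = 0 /\ hcomp degM y k = 0.
    by rewrite mem_undup mem_cat negb_or => /andP[/xs ? /yt].
  rewrite !(hE _ _ (undup_uniq (s ++ t))) => [|k /st[]|k /st[]|k /st[x0 y0]] //.
    by rewrite -big_split; apply: eq_bigr => k _; apply: qD.
  by rewrite hcompD // x0 y0 addr0.
have h0 : h 0 = 0 by apply: (addIr (h 0)); rewrite -hD !add0r.
have hg g : h (helt g) = p g.
  rewrite (hE _ [:: hdeg g]) // => [|k].
    rewrite big_seq1 /q.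
    rewrite (pZ 0 1 g) ?mul1r // ?add0r // ?scale1r.
      by apply/adeg0P; exists 1; rewrite scale1r.
    by rewrite [LHS]/helt /= (hcomp_hom gM _ (hdegP g)) eqxx.
  by rewrite inE (hcomp_hom gM _ (hdegP g)) => /negPf->.
have hZ a x : h (a *: x) = a * h x.
  elim/(grading_ind (int_adeg_grading (R i))): a => [|a b ha hb|e a Da].
  - by rewrite scale0r mul0r.
  - by rewrite scalerDl hD ha hb mulrDl.
  elim/(grading_ind gM): x => [|x y hx hy|k x Dx].
  - by rewrite scaler0 h0 mulr0.
  - by rewrite scalerDr !hD hx hy mulrDr.
  have Dax := mdegZ_int Da Dx.
  rewrite (hg (mk_homogeneous Dax)) (hg (mk_homogeneous Dx)).
  exact: (pZ e).
have hlin : linear (h : M i -> (R i)^o) by move=> a x y; rewrite hD hZ.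
pose hh : dual (M i) := HB.pack (h : M i -> (R i)^o)
  (GRing.isLinear.Build (R i) (M i) (R i)^o *:%R (h : M i -> (R i)^o) hlin).
by exists hh => g; rewrite -hg.
Qed.
End HomogeneousFunctionals.

(** * Multilinear maps as tensors of dual elements *)

Section SliceComparison.
Variables (K : fieldType) (I : finType).

Lemma tensor_slice_ext (V : I -> lmodType K) i (f f' : forall i, V i -> K)
    (t : tensor V) :
  (forall k, k != i -> f k = f' k) -> tensor_slice i f t = tensor_slice i f' t.
Proof.
move=> ff'; rewrite /tensor_slice; congr (tensor_lift _ t).
apply/funext => x; congr (_ *: _); apply: eq_bigr => k ki.
by rewrite ff'.
Qed.

Lemma tensor_slice_map (V W : I -> lmodType K) i (g : forall i, V i -> W i)
    (f : forall i, W i -> K) (t : tensor V) :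
  (forall i, linear (g i)) -> (forall k, k != i -> linear (f k : W k -> K^o)) ->
  g i (tensor_slice i (fun k => f k \o g k) t) = tensor_slice i f (tensor_map g t).
Proof.
move=> gl fl.
have fgl k : k != i -> linear (f k \o g k : V k -> K^o).
  by move=> /fl fkl a u v; rewrite /= gl fkl.
move: t; apply: tensor_ext => [a u v|a u v|x].
- by rewrite (tensor_slice_linear fgl) gl.
- by rewrite (tensor_map_linear gl) (tensor_slice_linear fl).
rewrite (tensor_map_pure gl) (tensor_slice_pure fl) (tensor_slice_pure fgl).
exact: (linear_funZ (gl i)).
Qed.

Variable R : I -> stdGradedAlg K.

(** Slices in slot i are linear over R i, which acts on slot i only. *)
Lemma tensor_slice_scalar i (f : forall i, R i -> K) (a : R i)
    (u : tensor_alg (fun i => R i)) :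
  (forall k, k != i -> linear (f k : R k -> K^o)) ->
  @tensor_slice K I (fun i => R i) i f (slot_scalar a * u) =
  a * @tensor_slice K I (fun i => R i) i f u.
Proof.
move=> fl; have mulr := tensor_map2_linearr (mul_bilinear (fun i => R i)).
have sl := @tensor_slice_linear K I (fun i => R i) f i fl.
move: u; apply: (@tensor_ext K I (fun i => R i) (R i)) => [c u v|c u v|x].
- by rewrite -[slot_scalar a * _]/(tensor_map2 _ _ _) mulr sl.
- by rewrite sl mulrDr scalerAr.
rewrite [slot_scalar a * _](tensor_map2_pure (mul_bilinear (fun i => R i))).
rewrite !(@tensor_slice_pure K I (fun i => R i) f i fl) dfwith_in -scalerAr.
congr (_ *: _); apply: eq_bigr => k ki.
by rewrite dfwith_out ?mul1r // eq_sym.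
Qed.
End SliceComparison.

Section Interpolation.
Variables (K : fieldType) (I : finType) (R : I -> stdGradedAlg K).
Hypothesis Rfriendly : friendly R.
Variables (M : forall i, fgGradedMod (R i)) (f : dual_segre M).

Local Notation tR := (tensor_alg (fun i => R i)).
Local Notation degR := (fun i => int_degree (@adeg K (R i))).
Local Notation degM := (fun i => @mdeg K (R i) (M i)).
Local Notation fM := (fun i => restrict_scalars (M i) : lmodType K).
Local Notation fD := (fun i => restrict_scalars (dual_gmod (M i)) : lmodType K).
Local Notation H := (homogeneous M).
Local Notation fV := (fun i => (H i -> R i) : lmodType K).

Definition fun_at (h : forall i, H i) i (p : H i -> R i) : R i := p (h i).

Lemma fun_at_linear h i : linear (@fun_at h i : fV i -> R i).
Proof. by []. Qed.

Local Notation eval h := (@tensor_map K I fV (fun i => R i) (fun_at h)).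

Variable s : (forall i, H i) -> tR.
Hypothesis sP : forall h, is_lift f (fun i => hdeg (h i)) (fun i => helt (h i)) (s h).

(** One term of the expansion of a multilinear map in slot i along generators: a
    function p, known at the generator g, contributes h |-> a h * p g, where a h is
    the coefficient of h on g. *)
Definition slot_expand i (a : H i -> R i) (g : H i) :
    forall k, (H k -> R k) -> (H k -> R k) :=
  dfwith (fun k => @id (H k -> R k)) (fun p h => a h * p g).
Arguments slot_expand [i] a g k p _.

Lemma eval_slot_expand h i (a : H i -> R i) (g : H i) (u : tensor fV) :
  eval h (@tensor_map K I fV fV (slot_expand a g) u) =
  slot_scalar (a (h i)) * eval (dfwith h g) u.
Proof.
have ol k : linear (slot_expand a g k : fV k -> fV k).
  rewrite /slot_expand; case: dfwithP => // c p q; apply/funext => h'.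
  rewrite -![(_ + _) _]/(_ + _) -![(c *: _) _]/(c *: _).
  by rewrite mulrDr scalerAr.
have mulr := tensor_map2_linearr (mul_bilinear (fun i => R i)).
have el h' := tensor_map_linear (@fun_at_linear h').
move: u; apply: (@tensor_ext K I fV (tensor (fun i => R i))) => [c u v|c u v|x].
- by rewrite (tensor_map_linear ol) el.
- by rewrite el; apply: mulr.
rewrite (tensor_map_pure ol) !(tensor_map_pure (@fun_at_linear _)).
rewrite [RHS](tensor_map2_pure (mul_bilinear (fun i => R i))).
congr pure; apply/functional_extensionality_dep => k; rewrite /fun_at /slot_expand.
case: dfwithP => [|l il]; first by rewrite !dfwith_in.
by rewrite !(dfwith_out _ _ il) mul1r.
Qed.

(** A map on tuples that is multilinear over the R i is determined by its finitely
    many values on tuples of homogeneous generators, so it is a finite sum of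
    products of one-variable functions, that is, a tensor of functions.  The
    slots are freed one at a time: P lists those in which h may vary. *)
Lemma interpolation : exists u : tensor fV, forall h, eval h u = s h.
Proof.
suff IP (P : seq I) (y : forall i, H i) : exists u : tensor fV, forall h,
    (forall j, j \notin P -> h j = y j) -> eval h u = s h.
  have y i : H i.
    by exists (0, 0); apply: (grading0 (@mdeg_grading K (R i) (M i))).
  have [u uE] := IP (enum I) y; exists u => h; apply: uE => j.
  by rewrite mem_enum.
elim: P y => [|i P IH] y.
  pose c i (a : R i) : fV i := fun=> a.
  have cl i : linear (@c i) by [].
  exists (tensor_map c (s y)) => h hy.
  have -> : h = y by apply/functional_extensionality_dep => j; apply: hy.
  move: (s y).
  apply: (@tensor_ext K I (fun i => R i) (tensor (fun i => R i))) => [a u v|//|x].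
    by rewrite (tensor_map_linear cl) (tensor_map_linear (@fun_at_linear y)).
  by rewrite (tensor_map_pure cl) (tensor_map_pure (@fun_at_linear y)).
have [ps [psD psE]] := homogeneous_generators (M i).
have gD l : degM i (nth 0 ps l).1 (nth 0 ps l).2.
  have [lt|ge] := ltnP l (size ps); first by apply: psD; apply: mem_nth.
  rewrite nth_default //; apply: (grading0 (@mdeg_grading K (R i) (M i))).
pose g l := mk_homogeneous (gD l).
have /family_choice[u uE] := fun l => IH (dfwith y (g l)).
have /family_choice[r rE] : forall h : H i, exists r : nat -> R i,
    (forall l, degR i (hdeg h - hdeg (g l)) (r l)) /\
    helt h = \sum_(l < size ps) r l *: helt (g l).
  move=> h; have [r rE] := psE (helt h).
  exists (fun l => hcomp (degR i) (r l) (hdeg h - hdeg (g l))); split.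
    by move=> l; apply: hcomp_deg; apply: int_adeg_grading.
  have gM := @mdeg_grading K (R i) (M i).
  rewrite -[LHS](_ : hcomp (degM i) (helt h) (hdeg h) = _); last first.
    by rewrite (hcomp_hom gM _ (hdegP h)) eqxx.
  rewrite {1}rE hcomp_big //; apply: eq_bigr => l _.
  exact: (hcomp_scale _ _ (hdegP (g l))).
exists (\sum_(l < size ps) @tensor_map K I fV fV
    (slot_expand (fun h => r h l) (g l)) (u l)) => h hy.
rewrite (linear_fun_sum (tensor_map_linear (@fun_at_linear h))).
rewrite -[in RHS](dfwith_id h i).
rewrite (lift_slot_comb Rfriendly sP _ (rE (h i)).1 (rE (h i)).2).
apply: eq_bigr => l _; rewrite eval_slot_expand uE // => j jP.
case: dfwithP jP => [|k ik] jP; first by rewrite dfwith_in.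
by rewrite dfwith_out // hy // inE negb_or eq_sym ik.
Qed.

(** The slices of the interpolating tensor inherit linearity over R i from s, so
    [pure_span_slices] replaces arbitrary functions by linear ones. *)
Lemma interpolation_by_duals : exists t : tensor fD, forall h,
  tensor_map (dual_at (fun i => helt (h i))) t = s h.
Proof.
have [u uE] := interpolation.
pose N i : set (fV i) := [set p | exists g : dual (M i), forall h, p h = g (helt h)].
pose L i : set (fV i -> K) := [set p | exists m : R i -> K,
  linear (m : R i -> K^o) /\ exists h, p = fun q => m (q h)].
have Lsep i : separating (@L i).
  move=> p p0; have /existsNP[h /eqP ph] : ~ forall h, p h = 0.
    by move=> pE; case/eqP: p0; apply/funext.
  have [m [ml mp]] := functionals_separate ph.
  by exists (fun q => m (q h)) => //; exists m; split=> //; exists h.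
have : pure_span N u.
  apply: (@pure_span_slices K I fV L) => //.
  - by move=> i _ [m [ml [h ->]]] a p q; apply: ml.
  - by move=> i; exists 0.
  - move=> i a p q [g gE] [g' gE']; exists (a%:A *: g + g') => h.
    by rewrite dualDE dualZE -gE -gE' mulr_algl.
  move=> i p pL.
  have /family_choice[m mP] : forall k, exists m : R k -> K, k != i ->
      linear (m : R k -> K^o) /\ exists h, p k = fun q => m (q h).
    move=> k; case: (eqVneq k i) => [_|/pL[m mP]]; first by exists (fun=> 0).
    by exists m.
  have y k : H k.
    by exists (0, 0); apply: (grading0 (@mdeg_grading K (R k) (M k))).
  have /family_choice[h hP] : forall k, exists h, k != i ->
      p k = fun q => m k (q h).
    move=> k; case: (eqVneq k i) => [_|/mP[_ [h hE]]]; first by exists (y k).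
    by exists h.
  have ml k : k != i -> linear (m k : R k -> K^o) by move=> /mP[].
  have sliceE g : tensor_slice i p u g =
      @tensor_slice K I (fun i => R i) i m (s (dfwith h g)).
    rewrite -uE -(tensor_slice_map _ (@fun_at_linear (dfwith h g)) ml).
    rewrite /fun_at dfwith_in; congr (_ g); apply: tensor_slice_ext => k ki.
    by rewrite (hP k ki); apply/funext => q /=; rewrite dfwith_out // eq_sym.
  apply: homogeneous_functional => [g1 g2 g e1 e2 gE|e a g g' Da gd gE].
    rewrite !sliceE (lift_slot_add Rfriendly sP _ e1 e2 gE).
    exact: (linear_funD (@tensor_slice_linear K I (fun i => R i) m i ml)).
  rewrite !sliceE (lift_slot_scale Rfriendly sP _ Da gd gE).
  exact: tensor_slice_scalar.
move=> Nu; have : exists t : tensor fD, forall h,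
    tensor_map (dual_at (fun i => helt (h i))) t = eval h u.
  elim: Nu => [|a _ u' [p /family_choice[g gE] ->] _ [t tE]].
    exists 0 => h; rewrite (linear_fun0 (tensor_map_linear (dual_at_linear _))).
    by rewrite (linear_fun0 (tensor_map_linear (@fun_at_linear h))).
  exists (a *: @pure K I fD g + t) => h.
  rewrite (tensor_map_linear (dual_at_linear _)) tE.
  rewrite (tensor_map_linear (@fun_at_linear h)).
  rewrite (tensor_map_pure (dual_at_linear _)) (tensor_map_pure (@fun_at_linear h)).
  congr (_ *: pure _ + _); apply/functional_extensionality_dep => i.
  by rewrite /fun_at gE.
by move=> [t tE]; exists t => h; rewrite tE uE.
Qed.
End Interpolation.

(** * Surjectivity, degrees and the theorem *)

Section DiagonalPart.
Variables (K : fieldType) (I : finType) (V : I -> lmodType K) (J : choiceType).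
Variables (D : forall i, J -> set (V i)).
Hypothesis gD : forall i, is_grading (@D i).
Hypothesis DZ : forall i j (a : K) (x : V i), @D i j x -> @D i j (a *: x).

Lemma hcomp_linear j i : linear (fun x : V i => hcomp (@D i) x j).
Proof. by move=> a x y; rewrite (hcompD (gD i)) (hcompZ gD DZ). Qed.

Lemma segre_proj_linear j : linear (segre_proj (@D) j).
Proof. exact: tensor_map_linear (hcomp_linear j). Qed.

Lemma segre_proj_pure j x :
  segre_proj (@D) j (pure x) = pure (fun i => hcomp (@D i) (x i) j).
Proof. exact: (tensor_map_pure (hcomp_linear j)). Qed.

Lemma segre_proj_finite (i0 : I) t : exists2 s : seq J, uniq s &
  forall j, j \notin s -> segre_proj (@D) j t = 0.
Proof.
elim/tensor_ind: t => [|a x t [s us st]].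
  by exists [::] => // j _; apply: linear_fun0 (segre_proj_linear j).
have [s' us' st'] := hcomp_finite (gD i0) (x i0).
exists (undup (s ++ s')) => [|j]; first exact: undup_uniq.
rewrite mem_undup mem_cat negb_or => /andP[/st tj /st' xj].
rewrite segre_proj_linear tj segre_proj_pure addr0.
by rewrite (multilinear0 (@pure_multilinear K I V) (i := i0)) ?scaler0.
Qed.

Definition diagonal_part (s : seq J) t := \sum_(j <- s) segre_proj (@D) j t.

Lemma diagonal_part_segre s t : segre_set (@D) (diagonal_part s t).
Proof.
apply: lspan_sum => j _; apply: lspan_sub (segre_proj_piece gD DZ j t).
by move=> u Du; exists j.
Qed.
End DiagonalPart.

Section Surjectivity.
Variables (K : fieldType) (I : finType) (i0 : I) (R : I -> stdGradedAlg K).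
Hypothesis Rfriendly : friendly R.
Variables (M : forall i, fgGradedMod (R i)).

Local Notation tR := (tensor_alg (fun i => R i)).
Local Notation degR := (fun i => int_degree (@adeg K (R i))).
Local Notation degM := (fun i => @mdeg K (R i) (M i)).
Local Notation degD := (fun i => @mdeg K (R i) (dual_gmod (M i))).
Local Notation fM := (fun i => restrict_scalars (M i) : lmodType K).
Local Notation fD := (fun i => restrict_scalars (dual_gmod (M i)) : lmodType K).

(** Evaluating the decomposition of g at x gives a decomposition of g x, in which
    the component of g of degree j contributes in degree k + j. *)
Lemma hcomp_dual i (g : dual (M i)) j k (x : M i) : degM i k x ->
  (hcomp (degD i) (g : dual_gmod (M i)) j : dual (M i)) x = hcomp (degR i) (g x) (k + j).
Proof.
move=> Dx; have gg := @mdeg_grading K (R i) (dual_gmod (M i)).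
have [s us sE] := hcomp_finite gg g.
have gE := hcomp_sum gg us sE.
rewrite (@hcomp_eq _ _ _ (int_adeg_grading (R i)) (g x)
  (fun e => (hcomp (degD i) (g : dual_gmod (M i)) (e - k) : dual (M i)) x)
  [seq k + d | d <- s]).
- by rewrite addrAC subrr add0r.
- by rewrite map_inj_uniq // => ? ? /addrI.
- move=> e; rewrite -(subrK k e) [X in degR i X]addrC addrK.
  exact: (hcomp_deg gg g (e - k) k x Dx).
- move=> e es; rewrite sE //; apply: contra es => es.
  by apply/mapP; exists (e - k) => //; rewrite addrC subrK.
rewrite big_map {1}gE dual_sumE; apply: eq_bigr => d _.
by rewrite addrAC subrr add0r.
Qed.

Lemma degD_scale i j (a : K) (g : fD i) : degD i j g -> degD i j (a *: g).
Proof.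
move=> Dg; rewrite -[j]add0r; apply: mdegZ => //.
by apply/adeg0P; exists a.
Qed.

Lemma degR_scale i j (a : K) (x : R i) : degR i j x -> degR i j (a *: x).
Proof.
move=> Dx; rewrite -mulr_algl -[j]add0r; apply: int_degree_mul => //.
by apply/adeg0P; exists a.
Qed.

Lemma degM_scale i j (a : K) (x : fM i) : degM i j x -> degM i j (a *: x).
Proof.
move=> Dx; rewrite -[j]add0r; apply: mdegZ => //.
by apply/adeg0P; exists a.
Qed.

Let gDual i := @mdeg_grading K (R i) (dual_gmod (M i)).
Let gRing i := int_adeg_grading (R i).

Let projD_linear := @segre_proj_linear K I fD int degD gDual degD_scale.
Let projD_pure := @segre_proj_pure K I fD int degD gDual degD_scale.
Let projR_linear := @segre_proj_linear K I (fun i => R i) int degR gRing degR_scale.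
Let projR_pure := @segre_proj_pure K I (fun i => R i) int degR gRing degR_scale.

Lemma eval_segre_proj j k (x : forall i, M i) (t : tensor fD) :
  (forall i, degM i k (x i)) ->
  tensor_map (dual_at x) (@segre_proj K I fD int degD j t) =
  @segre_proj K I (fun i => R i) int degR (k + j) (tensor_map (dual_at x) t).
Proof.
move=> Dx; have el := tensor_map_linear (dual_at_linear x).
move: t; apply: (@tensor_ext K I fD (tensor (fun i => R i))) => [a u v|a u v|g].
- by rewrite projD_linear el.
- by rewrite el projR_linear.
rewrite (tensor_map_pure (dual_at_linear x)).
rewrite projD_pure projR_pure.
rewrite (tensor_map_pure (dual_at_linear x)); congr pure.
by apply/functional_extensionality_dep => i; apply: hcomp_dual.
Qed.

Lemma segre_proj_sum_any (J : choiceType) (V : I -> lmodType K)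
   (D : forall i, J -> set (V i)) (gD : forall i, is_grading (@D i))
   (DZ : forall i j (a : K) (x : V i), @D i j x -> @D i j (a *: x)) (s : seq J) t :
  uniq s -> segre_set (@D) t ->
  (forall j, j \notin s -> segre_proj (@D) j t = 0) ->
  \sum_(j <- s) segre_proj (@D) j t = t.
Proof.
move=> us Dt s0; have [s' us' [s'0 tE]] := segre_proj_sum gD i0 DZ Dt.
by rewrite [RHS]tE -(fsum_seq us s0) (fsum_seq us' s'0).
Qed.

(** Scalars of K are absorbed in the slot i0, so pure tensors with entries of one
    degree generate the Segre product under addition alone. *)
Lemma segre_mod_ind (P : segre_mod (fun i => M i) -> Prop) :
  P 0 -> (forall x y, P x -> P y -> P (x + y)) ->
  (forall k x y, (forall i, degM i k (x i)) -> val y = @pure K I fM x -> P y) ->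
  forall y, P y.
Proof.
move=> P0 PD PP y; have /asboolP yS := valP y.
suff H z : @segre_set K I fM int degM z -> forall y : segre_mod (fun i => M i),
    val y = z -> P y by apply: H yS _ erefl.
elim=> {y yS} [y y0|a _ z' [k [x Dx ->]] Sz' IH y yE].
  by rewrite (_ : y = 0) //; apply: val_inj; rewrite y0.
have Dx' i : degM i k (dfwith x (a *: (x i0 : fM i0)) i).
  by case: dfwithP => // ; apply: degM_scale.
have [y1 y1E] := segre_modP Dx'.
have z'S : z' \in @segre_mod_pred K I R (fun i => M i) by apply/asboolP.
rewrite (_ : y = y1 + SegreMod z'S).
  by apply: PD; [apply: PP Dx' y1E | apply: IH].
apply: val_inj; rewrite yE [RHS]/= y1E; congr (_ + _).
have := @pure_multilinear K I fM x i0 a (x i0) 0.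
rewrite addr0 dfwith_id => ->.
have pm := @pure_multilinear K I fM.
by rewrite (@multilinear0 K I fM _ _ pm (dfwith x 0) i0) ?dfwith_in ?addr0.
Qed.

(** The tensor t of dual maps interpolating the lift of f need not lie in the Segre
    product of the duals; only its components of equal degree in all slots are
    kept.  On pure tensors of a common degree the values of t are already in T,
    so the other components contribute nothing there. *)
Lemma alpha_surjective (f : dual_segre M) : exists t, alpha M t = f.
Proof.
have [s sP] := graded_lift Rfriendly f.
have [t tE] := interpolation_by_duals Rfriendly sP.
have [js ujs js0] := @segre_proj_finite K I fD int degD gDual degD_scale i0 t.
have tS : @diagonal_part K I fD int degD js t \in
    @segre_mod_pred K I R (fun i => dual_gmod (M i)).
  exact/asboolP/(@diagonal_part_segre K I fD int degD gDual degD_scale).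
exists (SegreMod tS); apply: dualP; apply: segre_mod_ind.
- by rewrite !linear0.
- by move=> x y Px Py; rewrite !linearD Px Py.
move=> k x y Dx yE; apply: val_inj; rewrite alphaE yE tensor_eval_at /=.
pose h i := mk_homogeneous (Dx i).
have [Ds sE] := sP h.
have -> : val (f y) = s h.
  rewrite (sE k (fun=> 1)) => [|i|]; first exact: mul1r.
    by rewrite subrr; apply/adeg0P; exists 1; rewrite scale1r.
  rewrite yE; congr pure; apply/functional_extensionality_dep => i.
  by rewrite scale1r.
rewrite (linear_fun_sum (tensor_map_linear (dual_at_linear x))).
have tx : tensor_map (dual_at x) t = s h := tE h.
under eq_bigr => j _ do rewrite (eval_segre_proj _ _ Dx) tx.
rewrite -[LHS](big_map (fun j => k + j) xpredT
  (fun e => @segre_proj K I (fun i => R i) int degR e (s h))).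
apply: (@segre_proj_sum_any int (fun i => R i) degR gRing degR_scale).
- by rewrite map_inj_uniq // => ? ? /addrI.
- by apply: lspan_sub Ds => z [j uj]; exists (k + j).
move=> e ejs; rewrite -tx -(subrK k e) [e - k + k]addrC -(eval_segre_proj _ _ Dx).
rewrite js0 ?(linear_fun0 (tensor_map_linear (dual_at_linear x))) //.
apply: contra ejs => ejs; apply/mapP; exists (e - k) => //.
by rewrite addrC subrK.
Qed.

Lemma alpha_bijective : bijective (alpha M).
Proof.
have /family_choice[g gE] := alpha_surjective.
exists g => // t; apply: (alpha_injective Rfriendly); exact: gE.
Qed.

Lemma int_segre_degree (e : int) (a : segre_alg R) :
  @segre_piece K I (fun i => R i) int degR e (val a) ->
  int_degree (@segre_alg_deg K I R) e a.
Proof.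
case: e => // n aS; apply: val_inj => /=.
elim: aS => // c _ z [x Dx ->] _ ->; rewrite addr0.
by rewrite (multilinear0 (@pure_multilinear K I (fun i => R i)) (i := i0)) ?scaler0 ?Dx.
Qed.

Lemma alpha_deg j t : segre_dual_deg M j t -> dual_segre_deg M j (alpha M t).
Proof.
move=> Dt k y Dy; apply: int_segre_degree; rewrite alphaE.
apply: (@segre_piece_map2 K I fD fM (fun i => R i) _ int int int (fun j k => k + j)
  degD degM degR (eval_bilinear M) _ j k _ _ Dt Dy).
by move=> i j' k' g x Dg Dx; apply: (Dg k' x Dx).
Qed.

(** alpha respects degrees, so when alpha t has degree j the other components of t
    are mapped to 0, and injectivity removes them. *)
Lemma alpha_deg_inv j t : dual_segre_deg M j (alpha M t) -> segre_dual_deg M j t.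
Proof.
move=> Dt; have gS : is_grading (segre_dual_deg M) by apply: segre_mod_grading i0.
have gT : is_grading (int_degree (@segre_alg_deg K I R)).
  exact/int_degree_grading/segre_alg_grading.
have gM : is_grading (@segre_mod_deg K I R (fun i => M i)) by apply: segre_mod_grading i0.
have [js ujs js0] := hcomp_finite gS t.
have tE := hcomp_sum gS ujs js0.
have off e : e != j -> hcomp (segre_dual_deg M) t e = 0.
  move=> ej; apply: (alpha_injective Rfriendly); rewrite linear0; apply: dualP.
  apply: (grading_ind gM) => [|x y ex ey|k y Dy].
  - exact: linear0.
  - by rewrite linearD ex ey addr0.
  have Dc e' : int_degree (@segre_alg_deg K I R) (k + e')
      (alpha M (hcomp (segre_dual_deg M) t e') y).
    exact: (alpha_deg (hcomp_deg gS t e') Dy).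
  have aE : alpha M t y = \sum_(e' <- js) alpha M (hcomp (segre_dual_deg M) t e') y.
    rewrite {1}tE linear_sum; elim: (js) => [|a s IH]; first by rewrite !big_nil.
    by rewrite !big_cons dualDE IH.
  have := hcomp_hom gT (k + e) (Dt k y Dy).
  rewrite (inj_eq (addrI k)) (negPf ej) => c0; apply: etrans c0; apply/esym.
  rewrite (@hcomp_eq _ _ _ gT (alpha M t y)
    (fun e' => alpha M (hcomp (segre_dual_deg M) t (e' - k)) y) [seq k + e' | e' <- js]).
  - by rewrite [k + e]addrC addrK.
  - by rewrite map_inj_uniq // => ? ? /addrI.
  - by move=> e'; have := Dc (e' - k); rewrite [k + _]addrC subrK.
  - move=> e' e'js; rewrite js0 ?linear0 //; apply: contra e'js => e'js.
    by apply/mapP; exists (e' - k) => //; rewrite addrC subrK.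
  by rewrite big_map aE; apply: eq_bigr => d _; rewrite [k + d]addrC addrK.
rewrite tE; apply: (grading_sum gS) => e _.
have [->|/off ->] := eqVneq e j; first exact: hcomp_deg.
exact: (grading0 gS).
Qed.
End Surjectivity.

Theorem theorem1p3 (K : fieldType) (m : nat) (m_gt0 : (0 < m)%N)
    (R : 'I_m -> stdGradedAlg K) (R_friendly : friendly R)
    (M : forall i : 'I_m, fgGradedMod (R i)) :
  graded_isomorphism (segre_dual_deg M) (dual_segre_deg M) (alpha M).
Proof.
pose i0 := Ordinal m_gt0.
split=> [|j t]; first exact: (alpha_bijective i0 R_friendly).
by split; [apply: (alpha_deg i0) | apply: (alpha_deg_inv i0 R_friendly)].
Qed.
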